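(* Let $\pi : Y \to X$ be a finite dominant morphism of affine complex varieties. Then the image of the map $\varphi : \mathcal{K}^0(X(\mathbb{C})) \to \mathcal{K}^0(Y(\mathbb{C}))$, $f\mapsto f\circ\pi_{\mathbb{C}}$, is $$\operatorname{Im}(\varphi) = \{ f\in \mathcal{K}^0(Y(\mathbb{C})) \mid f \text{ is constant on the fibers of } \pi_{\mathbb{C}} \}.$$
   Context: An affine complex variety is $X=\operatorname{Spec}(\mathbb{C}[X])$ with $\mathbb{C}[X]$ a reduced finitely generated $\mathbb{C}$-algebra ($X$ need not be irreducible). $X(\mathbb{C})$ is the set of closed points of $X$, identified with a Zariski closed subset of some $\mathbb{C}^n$. A morphism $\pi:Y\to X$ induces $\pi^*:\mathbb{C}[X]\to\mathbb{C}[Y]$; it is finite if $\pi^*$ makes $\mathbb{C}[Y]$ a finite $\mathbb{C}[X]$-module, and dominant if and only if $\pi^*$ is injective. $\pi_{\mathbb{C}}:Y(\mathbb{C})\to X(\mathbb{C})$ is the restriction of $\pi$ to closed points. A function $f:X(\mathbb{C})\to\mathbb{C}$ is rational if it is regular on some Zariski dense Zariski open subset of $X(\mathbb{C})$. $\mathcal{K}^0(X(\mathbb{C}))$ is the ring of functions $f:X(\mathbb{C})\to\mathbb{C}$ that are rational and continuous on all of $X(\mathbb{C})$ for the Euclidean topology. *)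

(* Defs.v *)
From HB Require Import structures.
From mathcomp Require Import all_boot all_order all_algebra.
From mathcomp Require Import all_classical all_reals all_analysis.
From mathcomp Require Import complex.
Import Order.TTheory GRing.Theory Num.Theory.
Import numFieldNormedType.Exports.

Set Implicit Arguments.
Unset Strict Implicit.
Unset Printing Implicit Defensive.

Local Open Scope classical_set_scope.
Local Open Scope ring_scope.
Local Open Scope complex_scope.

(* A C-algebra is presented as a commutative ring with a structure morphism
   from C: unlike comAlgType, comPzRingType allows the zero ring, which is the
   coordinate ring of the empty variety. The finite family [coordinate] of
   generators is the choice of a closed embedding of X into C^embdim. *)
Record affine_variety (R : realType) := AffineVariety {
  regular : comPzRingType;
  scalar : {rmorphism R[i] -> regular};
  embdim : nat;
  coordinate : 'I_embdim -> regular;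
  coordinate_generate : forall S : set regular,
    range scalar `<=` S -> range coordinate `<=` S ->
    (forall a b, S a -> S b -> S (a + b)) ->
    (forall a b, S a -> S b -> S (a * b)) -> S = setT;
  regular_reduced : forall (a : regular) (n : nat), a ^+ n = 0 -> a = 0
}.

Section Points.
Variables (R : realType) (X : affine_variety R).

(* X(C): by the Nullstellensatz a closed point of Spec C[X] is the kernel of a
   unique C-algebra morphism p : C[X] -> C, and p a is the value of a there. *)
Record points := Point {
  eval :> {rmorphism regular X -> R[i]};
  eval_scalar : forall c : R[i], eval (scalar X c) = c
}.

HB.instance Definition _ := gen_eqMixin points.
HB.instance Definition _ := gen_choiceMixin points.

Definition zariski_open (U : set points) : Prop :=
  exists S : set (regular X), U = [set p | exists2 a, S a & p a != 0].

Definition zariski_dense (U : set points) : Prop :=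
  forall V, zariski_open V -> V !=set0 -> U `&` V !=set0.

Definition regular_on (U : set points) (f : points -> R[i]) : Prop :=
  forall p, U p -> exists (V : set points) (a b : regular X),
    [/\ zariski_open V, V p, V `<=` U &
        forall q, V q -> q b != 0 /\ f q = q a / q b].

Definition rational_fun (f : points -> R[i]) : Prop :=
  exists U, [/\ zariski_open U, zariski_dense U & regular_on U f].

(* R[i]^o is R[i] with the topology of its norm; the Euclidean topology on X(C)
   is the one induced by the embedding. *)
Definition embedding (p : points) : 'rV[R[i]^o]_(embdim X) :=
  \row_i p (coordinate i).

Definition euclidean_continuous (f : points -> R[i]) : Prop :=
  continuous (f : initial_topology embedding -> R[i]^o).

Definition K0 : set (points -> R[i]) :=
  [set f | rational_fun f /\ euclidean_continuous f].

End Points.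

Arguments K0 {R} X.

(* A morphism Y -> X is given by its comorphism C[X] -> C[Y]. *)
Record morphism (R : realType) (Y X : affine_variety R) := Morphism {
  comorphism : {rmorphism regular X -> regular Y};
  comorphism_scalar : forall c : R[i], comorphism (scalar X c) = scalar Y c
}.

Section Morphisms.
Variables (R : realType) (Y X : affine_variety R) (pi : morphism Y X).

Definition finite_morphism : Prop :=
  exists (m : nat) (e : 'I_m -> regular Y), forall b : regular Y,
    exists c : 'I_m -> regular X, b = \sum_(j < m) comorphism pi (c j) * e j.

Definition dominant : Prop := injective (comorphism pi).

Fact on_points_subproof (q : points Y) (c : R[i]) :
  (q \o comorphism pi) (scalar X c) = c.
Proof. by rewrite /= comorphism_scalar eval_scalar. Qed.

(* pi_C : Y(C) -> X(C); on closed points, the preimage of ker q by the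
   comorphism is the kernel of the composite. *)
Definition on_points (q : points Y) : points X :=
  @Point R X (q \o comorphism pi) (on_points_subproof q).

Definition constant_on_fibers (f : points Y -> R[i]) : Prop :=
  forall q1 q2 : points Y, on_points q1 = on_points q2 -> f q1 = f q2.

End Morphisms.

(* Main.v *)
Require Import Defs.
From HB Require Import structures.
From mathcomp Require Import all_boot all_order all_algebra.
From mathcomp Require Import all_classical all_reals all_analysis.
From mathcomp Require Import complex ring.
Import Order.TTheory GRing.Theory Num.Theory.
Import numFieldNormedType.Exports.

Set Implicit Arguments.
Unset Strict Implicit.
Unset Printing Implicit Defensive.

(** A continuous function [f] on X(C) is rational exactly when its graph is
    Zariski closed in X(C) x C, and the second condition travels both ways along
    a finite morphism. Nothing is assumed about the components of X and Y, so
    pulling back rationality directly is impossible: a component of Y may map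
    into the locus where [f] is not regular.

    From rational to closed graph ([fractional_closed_graph]). Let [J] be the
    ideal of C[X][T] of the relations holding on the graph of [f], and let [f]
    be regular on the Zariski dense open set U. A point (p, t) of the zero set
    of [J] is a Euclidean limit of points of that zero set lying over U, because
    a Zariski dense open subset is Euclidean dense
    ([zariski_dense_euclidean]). Over U the second coordinate is the value of
    [f], so continuity of [f] at p forces t = f p.

    From closed graph to rational ([closed_graph_fractional]). Work modulo a
    prime [P = (0 : s)] of C[X] and take [F] of least degree m in [J] whose
    leading coefficient a is not in [P]. By pseudo-division every root of [F] at
    a point q with (s a)(q) <> 0 satisfies all of [J], hence equals f q. So [F]
    specializes to a(q) (T - f q)^m, and reading the coefficient of T^(m-1)
    exhibits [f] as a fraction with denominator m a; characteristic 0 is used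
    here.

    Transport along [pi]. Pulling back a closed graph is immediate
    ([closed_graph_pullback]); pushing it forward is lying over for
    C[X][T] -> C[Y][T] ([closed_graph_pushforward]). Continuity pushes forward
    because a finite morphism is proper: along an ultrafilter on which the
    images converge, every element of C[Y], being integral, converges, and the
    limits form a point of Y ([point_limit]).

    Euclidean density is the analytic heart ([points_near_in_domain]). For a
    finitely generated domain B and a point q, Noether normalization gives an
    integral extension of a polynomial ring Q. Follow a line in the affine space
    of Q through the image of q, along which the open condition holds
    generically, and choose z in B with z(q) = 0 that separates q from the other
    points of its fibre. The kernel of Q[T] -> B, T |-> z, is generated by a
    monic polynomial (Gauss's lemma for Q), so near the parameter 0 it has a
    small root, which lifts to a point of B by lying over. Limits of these
    points lie over the image of q and annihilate z, so they are q.

    The points of X enter only through their evaluation morphisms C[X] -> C, and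
    Euclidean convergence of points is pointwise convergence on C[X]. *)

(** * Ideals in Noetherian rings *)

Section Ideals.
Local Open Scope classical_set_scope.
Local Open Scope ring_scope.

Definition is_ideal (A : comNzRingType) (J : set A) : Prop :=
  [/\ J 0, forall a b, J a -> J b -> J (a + b) & forall a b, J b -> J (a * b)].

(** Generation by [s] is expressed by quantifying over the ideals that contain
    [s], which avoids manipulating linear combinations. *)
Definition noetherian (A : comNzRingType) : Prop :=
  forall I : set A, is_ideal I -> exists s : seq A, (forall x, x \in s -> I x) /\
    forall J, is_ideal J -> (forall x, x \in s -> J x) -> I `<=` J.

Lemma is_ideal_opp (A : comNzRingType) (J : set A) a :
  is_ideal J -> J a -> J (- a).
Proof. by case=> _ _ JM Ja; rewrite -mulN1r; apply: JM. Qed.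

Lemma is_ideal_preim (A B : comNzRingType) (h : {rmorphism A -> B}) (J : set B) :
  is_ideal J -> is_ideal (h @^-1` J).
Proof.
case=> J0 JD JM; split=> /= [|a b Ja Jb|a b Jb]; first by rewrite rmorph0.
  by rewrite rmorphD; apply: JD.
by rewrite rmorphM; apply: JM.
Qed.

Lemma noetherian_field (K : fieldType) : noetherian K.
Proof.
move=> I [I0 ID IM]; have [[x [Ix x0]]|I00] := pselect (exists x, I x /\ x != 0).
  exists [:: x]; split=> [y|J [_ _ JM] /(_ x (mem_head _ _)) Jx y _].
    by rewrite inE => /eqP ->.
  by rewrite -[y](divfK x0); apply: JM.
exists [::]; split=> // J [J0 _ _] _ x Ix.
by have [-> //|x0] := eqVneq x 0; case: I00; exists x.
Qed.

Lemma noetherian_surj (A B : comNzRingType) (h : {rmorphism A -> B}) :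
  (forall b, exists a, h a = b) -> noetherian A -> noetherian B.
Proof.
move=> hS nA I idI; have [s [sI Is]] := nA _ (is_ideal_preim h idI).
exists (map h s); split=> [_ /mapP[x xs ->]|J idJ sJ b]; first exact: sI.
have [a <-] := hS b; apply: (Is _ (is_ideal_preim h idJ)) => x xs.
by apply: sJ; apply: map_f.
Qed.

(** Along a chain of ideals, the finitely many generators of the union already
    lie in one member, so Zorn's lemma applies to any family of ideals. *)
Lemma noetherian_max (A : comNzRingType) (P : set (set A)) (I0 : set A) :
  noetherian A -> P I0 -> (forall I, P I -> is_ideal I) ->
  exists2 M, P M & forall I, P I -> M `<=` I -> I `<=` M.
Proof.
move=> nA PI0 Pid; pose Q : set (set A) := [set I | I = set0 \/ P I].
have [|M [QM Mmax]] := @Zorn_bigcup _ Q.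
  move=> F FQ Ftot; pose U := \bigcup_(X in F) X.
  have [[x [X FX Xx]]|U0] := pselect (U !=set0); last first.
    by left; apply/seteqP; split=> // x Ux; case: U0; exists x.
  have Fid Y y : F Y -> Y y -> is_ideal Y.
    by move=> FY Yy; case: (FQ Y FY) => [Y0|/Pid//]; rewrite Y0 in Yy.
  have Uid : is_ideal U.
    split=> [|a b [Y FY Ya] [Z FZ Zb]|a b [Y FY Yb]].
    - by exists X => //; case: (Fid _ _ FX Xx).
    - case: (Ftot Y Z FY FZ) => YZ.
        by exists Z => //; case: (Fid _ _ FZ Zb) => _ + _; apply=> //; apply: YZ.
      by exists Y => //; case: (Fid _ _ FY Ya) => _ + _; apply=> //; apply: YZ.
    - by exists Y => //; case: (Fid _ _ FY Yb) => _ _; apply.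
  have [s [sU Us]] := nA _ Uid.
  have [Y FY sY] : exists2 Y, F Y & Y !=set0 /\ forall y, y \in s -> Y y.
    elim: s sU {Us} => [|a s IHs] sU; first by exists X => //; split; first exists x.
    have [|Y FY [Yn sY]] := IHs; first by move=> y ys; apply: sU; rewrite inE ys orbT.
    have [Z FZ Za] := sU a (mem_head _ _).
    case: (Ftot Y Z FY FZ) => YZ.
      exists Z => //; split; first by exists a.
      by move=> y; rewrite inE => /predU1P[->//|/sY]; apply: YZ.
    exists Y => //; split=> // y; rewrite inE => /predU1P[->|/sY//]; exact: YZ.
  case: sY => -[y Yy] sY.
  suff UY : U = Y by rewrite -/U UY; exact: FQ.
  apply/seteqP; split; last by move=> z Yz; exists Y.
  exact: Us (Fid _ _ FY Yy) sY.
have PM : P M.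
  case: QM => // M0; have [/(congr1 (fun I => I 0))|MI] := pselect (M = I0).
    by rewrite M0 /= => E; case: (Pid _ PI0) => + _ _; rewrite -E.
  case: (Mmax I0); last by right.
  by rewrite properEneq; split; [exact/eqP|rewrite M0].
exists M => // I PI MI; apply: contrapT => nIM; case: (Mmax I); last by right.
by split.
Qed.

(** Hilbert's basis theorem. The ideals of coefficients of [X^n] of the elements
    of degree at most [n] stabilize at some [N]; generators of the first [N + 1]
    of them, lifted to polynomials, generate the ideal. *)
Lemma noetherian_poly (A : comNzRingType) : noetherian A -> noetherian {poly A}.
Proof.
move=> nA I idI; have [I0 ID IM] := idI.
pose lcs (S : set {poly A}) n : set A :=
  [set a | exists p, [/\ S p, (size p <= n.+1)%N & p`_n = a]].
have lcs_id S n : is_ideal S -> is_ideal (lcs S n).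
  case=> S0 SD SM; split.
  - by exists 0; rewrite size_poly0 coef0.
  - move=> a b [p [Sp sp <-]] [q [Sq sq <-]]; exists (p + q); split.
    + exact: SD.
    + by rewrite (leq_trans (size_polyD _ _)) // geq_max sp.
    + by rewrite coefD.
  - move=> a b [p [Sp sp <-]]; exists (a%:P * p); split; first exact: SM.
      by rewrite mul_polyC (leq_trans (size_scale_leq _ _)).
    by rewrite coefCM.
have lcs_mono S m n a : is_ideal S -> (m <= n)%N -> lcs S m a -> lcs S n a.
  case=> S0 SD SM mn [p [Sp sp <-]]; exists ('X^(n - m) * p); split.
  - exact: SM.
  - have [->|p0] := eqVneq p 0; first by rewrite mulr0 size_poly0.
    by rewrite size_monicM ?monicXn // size_polyXn addSn /= -(subnK mn) addnK -addnS leq_add2l.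
  - by rewrite coefXnM ltnNge leq_subr /= subKn.
pose L : set A := \bigcup_n lcs I n.
have Lid : is_ideal L.
  split=> [|a b [m _ ma] [n _ nb]|a b [n _ nb]].
  - by exists 0%N => //; case: (lcs_id I 0%N idI).
  - exists (maxn m n) => //; case: (lcs_id I (maxn m n) idI) => _ + _; apply.
      by apply: lcs_mono ma; rewrite ?leq_maxl.
    by apply: lcs_mono nb; rewrite ?leq_maxr.
  - by exists n => //; case: (lcs_id I n idI) => _ _; apply.
have [s [sL Ls]] := nA _ Lid.
have [N sN] : exists N, forall a, a \in s -> lcs I N a.
  elim: s sL {Ls} => [|a s IHs] sL; first by exists 0%N.
  have [|N sN] := IHs; first by move=> x xs; apply: sL; rewrite inE xs orbT.
  have [n _ na] := sL a (mem_head _ _).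
  exists (maxn N n) => b; rewrite inE => /predU1P[->|/sN bN].
    by apply: lcs_mono na; rewrite ?leq_maxr.
  by apply: lcs_mono bN; rewrite ?leq_maxl.
have gens n : {G : seq {poly A} | (forall g, g \in G -> I g /\ (size g <= n.+1)%N) /\
    forall J, is_ideal J -> (forall g, g \in G -> J g`_n) -> lcs I n `<=` J}.
  apply: cid; have [t [tL Lt]] := nA _ (lcs_id I n idI).
  have ex a : exists p : {poly A}, a \in t -> [/\ I p, (size p <= n.+1)%N & p`_n = a].
    have [/tL[p pP]|nt] := boolP (a \in t); first by exists p.
    by exists 0.
  have [F FP] := choice ex.
  exists (map F t); split=> [_ /mapP[a /FP[? ? _] ->]//|J idJ JF].
  apply: Lt => // a at_; have [_ _ <-] := FP _ at_.
  exact/JF/map_f.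
pose S := flatten [seq sval (gens n) | n <- iota 0 N.+1].
have inS n g : (n <= N)%N -> g \in sval (gens n) -> g \in S.
  move=> nN gn; apply/flattenP; exists (sval (gens n)) => //.
  by apply/map_f; rewrite mem_iota.
exists S; split=> [g /flattenP[_ /mapP[n _ ->]]|J idJ SJ].
  by case: (svalP (gens n)) => + _ => /[apply] -[].
have IJid : is_ideal (I `&` J).
  case: idJ => J0 JD JM; split=> [//|a b [? ?] [? ?]|a b [? ?]].
    by split; [apply: ID|apply: JD].
  by split; [apply: IM|apply: JM].
suff H n (p : {poly A}) : (size p <= n)%N -> I p -> J p.
  by move=> p; apply: H (leqnn _).
elim: n p => [|n IHn] p sp Ip.
  by move: sp; rewrite size_poly_leq0 => /eqP ->; case: idJ.
suff [q [[Iq Jq] sq qn]] : lcs (I `&` J) n p`_n.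
  rewrite -(subrK q p); case: (idJ) => _ + _; apply=> //; apply: IHn; last first.
    by apply: ID => //; apply: is_ideal_opp.
  apply/leq_sizeP => j; rewrite leq_eqVlt coefB => /predU1P[<-|nj].
    by rewrite qn subrr.
  by rewrite !(nth_default 0) ?subrr // (leq_trans _ nj).
have small m : (m <= N)%N -> lcs I m `<=` lcs (I `&` J) m.
  move=> mN; have [GI GL] := svalP (gens m); apply: GL; first exact: lcs_id.
  by move=> g gm; have [Ig sg] := GI g gm; exists g; split=> //; split=> //; apply/SJ/(inS m).
have [nN|/ltnW Nn] := leqP n N; first by apply: small => //; exists p.
apply: (@lcs_mono _ N) => //; apply: (Ls _ (lcs_id _ N IJid)); last by exists n => //; exists p.
by move=> a /sN aN; apply: small.
Qed.

(** Associated primes: among the ideals [(J : s)] that avoid [M], a maximal one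
    is prime. With [M] the complement of the ideal of a point this selects a
    component through that point; with [M] the powers of [c] it selects a
    component on which [c] does not vanish. *)
Lemma prime_colon_ideal (A : comNzRingType) (J M : set A) :
  noetherian A -> is_ideal J -> M 1 -> (forall x y, M x -> M y -> M (x * y)) ->
  (forall x, M x -> ~ J x) ->
  exists s, (forall x, M x -> ~ J (x * s)) /\
            (forall x y, J (x * y * s) -> J (x * s) \/ J (y * s)).
Proof.
move=> nA idJ M1 MM MJ; have [J0 JD JM] := idJ.
pose col s : set A := [set x | J (x * s)].
have colid s : is_ideal (col s).
  split=> [|a b|a b]; rewrite /col /= ?mul0r ?mulrDl -?mulrA //;
    [exact: JD|exact: JM].
pose good s := forall x, M x -> ~ J (x * s).
have [|I [s [sg ->]]|_ [s [sg ->]] smax] :=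
  @noetherian_max A [set I | exists s, good s /\ I = col s] (col 1) nA.
- by exists 1; split=> // x Mx; rewrite mulr1; apply: MJ.
- exact: colid.
exists s; split=> // x y Jxys.
have [[u [Mu Jusy]]|ngood] := pselect (exists u, M u /\ J (u * (y * s))); last first.
  left; apply: (smax (col (y * s))); rewrite /col /= ?mulrA //.
    by exists (y * s); split=> // u Mu Ju; apply: ngood; exists u.
  by move=> z /= Jzs; rewrite /col /= mulrCA; apply: JM.
right; apply: (smax (col (u * s))) => /=.
- exists (u * s); split=> // v Mv Jv; apply: (sg (v * u)); first exact: MM.
  by rewrite -mulrA.
- by move=> z /= Jzs; rewrite /col /= mulrCA; apply: JM.
- by rewrite /col /= mulrCA.
Qed.

End Ideals.

Section Quotient.
Local Open Scope classical_set_scope.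
Local Open Scope ring_scope.

Lemma ideal_quotient (A : comNzRingType) (J : set A) :
  is_ideal J -> ~ J 1 ->
  exists (D : comNzRingType) (h : {rmorphism A -> D}),
    (forall d, exists a, h a = d) /\ (forall a, h a = 0 <-> J a).
Proof.
move=> [J0 JD JM] J1; pose S : A -> bool := fun x => `[< J x >].
have Scl : idealr_closed S.
  split; rewrite ?unfold_in; [exact/asboolP|exact/asboolPn|].
  move=> a u v /asboolP Ju /asboolP Jv; apply/asboolP; apply: JD => //; exact: JM.
pose I : idealr A := HB.pack S (isIdealr.Build A S Scl).
exists {ideal_quot I}, \pi_{ideal_quot I}%qT; split=> [d|a].
  by exists (repr d); exact: (@reprK _ {ideal_quot I} d).
rewrite -(rmorph0 (\pi_{ideal_quot I}%qT : {rmorphism A -> {ideal_quot I}})).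
split=> [/eqP|Ja]; last apply/eqP; rewrite -Quotient.idealrBE subr0.
  by move/asboolP.
exact/asboolP.
Qed.

End Quotient.

(** * Lying over *)

Section Lying.
Local Open Scope classical_set_scope.
Local Open Scope ring_scope.

(** Take an ideal [I] of [B] maximal among those that contain [J] and contract
    into the kernel of [p]. It is prime and contracts to that kernel exactly, so
    modulo [I] the coefficients of an integral equation become constants; the
    equation then splits, and [B / I] is [K] itself. *)
Lemma lying_over (K : closedFieldType) (A B : comNzRingType)
    (sA : {rmorphism K -> A}) (h : {rmorphism A -> B}) (J : set B)
    (p : {rmorphism A -> K}) :
  (forall b, integralOver h b) -> is_ideal J -> (forall c, p (sA c) = c) ->
  (forall a, J (h a) -> p a = 0) ->
  exists q : {rmorphism B -> K},
    (forall a, q (h a) = p a) /\ (forall b, J b -> q b = 0).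
Proof.
move=> hint idJ psA Jp.
pose P : set (set B) := [set I | I = set0 \/
  [/\ is_ideal I, J `<=` I & forall a, I (h a) -> p a = 0]].
have [|I [PI Imax]] := @Zorn_bigcup _ P.
  move=> F FP Ftot; pose U := \bigcup_(X in F) X.
  have [[x [X FX Xx]]|U0] := pselect (U !=set0); last first.
    by left; apply/seteqP; split=> // x Ux; case: U0; exists x.
  have Fid Y y : F Y -> Y y ->
      [/\ is_ideal Y, J `<=` Y & forall a, Y (h a) -> p a = 0].
    by move=> FY Yy; case: (FP Y FY) => [Y0|//]; rewrite Y0 in Yy.
  right; split=> [|y Jy|a [Y FY /= Ya]].
  - split=> [|a b [Y FY Ya] [Z FZ Zb]|a b [Y FY Yb]].
    + by exists X => //; case: (Fid _ _ FX Xx) => -[].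
    + case: (Ftot Y Z FY FZ) => YZ.
        by exists Z => //; case: (Fid _ _ FZ Zb) => -[_ + _ _ _]; apply=> //; apply: YZ.
      by exists Y => //; case: (Fid _ _ FY Ya) => -[_ + _ _ _]; apply=> //; apply: YZ.
    + by exists Y => //; case: (Fid _ _ FY Yb) => -[_ _ + _ _]; apply.
  - by exists X => //; case: (Fid _ _ FX Xx) => _ + _; apply.
  - by case: (Fid _ _ FY Ya) => _ _; apply.
have {PI Imax} [[I0 ID IM] JI Ip Imax] : [/\ is_ideal I, J `<=` I,
    forall a, I (h a) -> p a = 0 &
    forall I', is_ideal I' -> I `<=` I' ->
      (forall a, I' (h a) -> p a = 0) -> I' `<=` I].
  have Jmax : P J by right; split.
  case: PI => [I0|[idI JI Ip]]; last first.
    split=> // I' idI' II' I'p; apply: contrapT => nI'I.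
    by case: (Imax I'); [split|right; split=> //; apply: subset_trans II'].
  case: (Imax J) => //; rewrite I0 properEneq; split=> //; apply/eqP => /esym/seteqP[+ _].
  by case: idJ => J0 _ _ /(_ 0 J0).
have adj b : ~ I b -> exists a y, I (h a - y * b) /\ p a != 0.
  move=> nIb; apply: contrapT => noa; apply: nIb.
  pose I' := [set x | exists y, I (x - y * b)].
  apply: (Imax I'); rewrite /I' /=.
  - split=> [|x y [x' Ix] [y' Iy]|x y [y' Iy]].
    + by exists 0; rewrite mul0r subrr.
    + exists (x' + y'); rewrite mulrDl opprD addrACA; exact: ID.
    + by exists (x * y'); rewrite -mulrA -mulrBr; exact: IM.
  - by move=> x Ix /=; exists 0; rewrite mul0r subr0.
  - move=> a [y Iy]; have [//|pa] := eqVneq (p a) 0; case: noa; exists a, y.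
    by split.
  - by exists 1; rewrite mul1r subrr.
have Iprime x y : I (x * y) -> I x \/ I y.
  move=> Ixy; have [Ix|/adj[a [u [Ia pa]]]] := pselect (I x); first by left.
  have [Iy|/adj[b [v [Ib pb]]]] := pselect (I y); first by right.
  have /Ip /eqP : I (h (a * b)).
    rewrite rmorphM -(subrK (u * x * (v * y)) (h a * h b)); apply: (ID); last first.
      by rewrite mulrACA; apply: (IM).
    have -> : h a * h b - u * x * (v * y) =
      h b * (h a - u * x) + (u * x) * (h b - v * y).
      by rewrite !mulrBr (mulrC (h b) (h a)) addrA (mulrC (h b)) subrK.
    by apply: (ID); apply: (IM).
  by rewrite rmorphM mulf_eq0 (negPf pa) (negPf pb).
have IX x n : I (x ^+ n) -> I 1 \/ I x.
  elim: n => [|n IHn]; first by rewrite expr0; left.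
  by rewrite exprS => /Iprime[]; [right|].
have nI1 : ~ I 1.
  rewrite -(rmorph1 h) => /Ip /eqP; rewrite rmorph1; exact/negP/oner_neq0.
(* If h a were not in I, some h s congruent to b * h a modulo I would have
   p s <> 0; homogenizing an integral equation of b by powers of a turns it into
   an equation for s whose non-leading coefficients are killed by p. *)
have kerI a : p a = 0 -> I (h a).
  move=> pa; apply: contrapT => /adj[s [b [Is ps]]].
  have [F Fmon /rootP] := hint b.
  rewrite horner_coef size_map_poly_id0; last by rewrite (monicP Fmon) rmorph1 oner_neq0.
  set n := size F => F0.
  have n0 : n != 0%N by rewrite size_poly_eq0 monic_neq0.
  have E : h (\sum_(i < n) F`_i * a ^+ (n.-1 - i) * s ^+ i) =
    \sum_(i < n) (h F`_i * h a ^+ (n.-1 - i) * (h s ^+ i - (b * h a) ^+ i)).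
    apply/eqP; rewrite -subr_eq0 rmorph_sum -sumrB.
    rewrite (eq_bigr (fun i : 'I_n => h a ^+ n.-1 * ((map_poly h F)`_i * b ^+ i))); last first.
      move=> i _; rewrite coef_map /= !rmorphM !rmorphXn /= mulrBr opprB addrC subrK.
      have -> : h a ^+ n.-1 = h a ^+ (n.-1 - i) * h a ^+ i.
        by rewrite -exprD subnK // -ltnS prednK ?lt0n.
      by rewrite exprMn; rewrite -!mulrA mulrC -!mulrA; congr (_ * _); rewrite mulrC -!mulrA.
    by rewrite -mulr_sumr F0 mulr0.
  have /Ip : I (h (\sum_(i < n) F`_i * a ^+ (n.-1 - i) * s ^+ i)).
    rewrite E; apply: big_ind => // i _; apply: (IM).
    by rewrite subrXX mulrC; apply: (IM).
  rewrite -[in X in p X](prednK (n := n)) ?lt0n // big_ord_recr /= subnn expr0 mulr1.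
  rewrite -lead_coefE (monicP Fmon) mul1r rmorphD rmorph_sum big1 ?add0r => [/eqP|i _].
    by rewrite rmorphXn expf_eq0 (negPf ps) andbF.
  by rewrite !rmorphM rmorphXn /= pa expr0n subn_eq0 leqNgt ltn_ord /= mulr0 mul0r.
have hsA a : I (h a - h (sA (p a))).
  by rewrite -rmorphB; apply: kerI; rewrite rmorphB psA subrr.
have ex b : exists c, I (b - h (sA c)).
  have [F Fmon /rootP F0] := hint b.
  have [r rE] := closed_field_poly_normal (map_poly p F).
  have Fp : map_poly p F \is monic by apply: monic_map.
  rewrite (monicP Fp) scale1r in rE.
  have : I (\prod_(z <- r) (b - h (sA z))).
    have -> : \prod_(z <- r) (b - h (sA z)) =
       (map_poly h (map_poly sA (map_poly p F))).[b].
      rewrite rE !rmorph_prod horner_prod; apply: eq_bigr => z _.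
      by rewrite /= !map_polyXsubC !hornerE.
    rewrite -[X in I X]subr0 -F0 -hornerN -hornerD horner_coef.
    apply: big_ind => // i _; rewrite mulrC; apply: (IM).
    rewrite coefD coefN !coef_map /= -opprB -mulN1r; exact/IM/hsA.
  elim: r {rE} => [|z r IHr]; first by rewrite big_nil => /nI1.
  by rewrite big_cons => /Iprime[]; [exists z|].
(* The residue of b is unique, so choosing it defines a ring morphism. *)
have uniq c d : I (h (sA c) - h (sA d)) -> c = d.
  by rewrite -!rmorphB => /Ip; rewrite psA => /subr0_eq.
have [q qP] := choice ex.
have qE b c : I (b - h (sA c)) -> q b = c.
  move=> Ib; apply: uniq; rewrite -(subrK b (h (sA (q b)))) -addrA; apply: (ID) => //.
  by rewrite -opprB -mulN1r; apply: (IM).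
have qadd : zmod_morphism q.
  move=> x y; apply: qE; rewrite !rmorphB /=.
  have -> : x - y - (h (sA (q x)) - h (sA (q y))) =
    (x - h (sA (q x))) + -1 * (y - h (sA (q y))).
    by rewrite mulN1r !opprB addrACA [RHS]addrACA (addrC (- y)).
  by apply: (ID) => //; apply: (IM).
have qmul : monoid_morphism q.
  split=> [|x y]; apply: qE; first by rewrite !rmorph1 subrr.
  rewrite !rmorphM /=.
  have -> : x * y - h (sA (q x)) * h (sA (q y)) =
    y * (x - h (sA (q x))) + h (sA (q x)) * (y - h (sA (q y))).
    by rewrite !mulrBr (mulrC y x) (mulrC y) addrA subrK.
  by apply: (ID); apply: (IM).
pose qR : {rmorphism B -> K} := HB.pack q (GRing.isZmodMorphism.Build _ _ q qadd)
  (GRing.isMonoidMorphism.Build _ _ q qmul).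
exists qR; split=> [a|b Jb] /=; first exact: qE.
by apply: qE; rewrite !rmorph0 subr0; apply: (JI).
Qed.

End Lying.

(** * Polynomial rings and integral elements *)

Section PolyEval.
Local Open Scope ring_scope.
Variables (A B : comNzRingType) (h : {rmorphism A -> B}) (t : B).

Definition poly_ev : {rmorphism {poly A} -> B} := horner_eval t \o map_poly h.

Lemma poly_evE p : poly_ev p = (map_poly h p).[t].
Proof. by []. Qed.

Lemma poly_evC a : poly_ev a%:P = h a.
Proof. by rewrite poly_evE map_polyC hornerC. Qed.

Lemma poly_evX : poly_ev 'X = t.
Proof. by rewrite poly_evE map_polyX hornerX. Qed.

End PolyEval.

Arguments poly_ev : simpl never.

Section Integral.
Local Open Scope ring_scope.

Lemma rmorph_poly_sum (A B : comNzRingType) (h : {rmorphism {poly A} -> B}) p :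
  h p = \sum_(i < size p) h (p`_i)%:P * h 'X ^+ i.
Proof.
rewrite -[p in LHS]coefK poly_def rmorph_sum; apply: eq_bigr => i _ /=.
by rewrite -mul_polyC rmorphM rmorphXn.
Qed.

Lemma rmorph_polyE (A B : comNzRingType) (h : {rmorphism {poly A} -> B})
    (g : {rmorphism A -> B}) p :
  (forall a, h a%:P = g a) -> h p = (map_poly g p).[h 'X].
Proof.
move=> hg; rewrite rmorph_poly_sum (horner_coef_wide _ (size_poly _ _)).
by apply: eq_bigr => i _; rewrite coef_map /= hg.
Qed.

Lemma integralOver_base (A A' B : comNzRingType) (g : {rmorphism A' -> A})
    (h' : {rmorphism A' -> B}) (h : {rmorphism A -> B}) b :
  (forall a, h (g a) = h' a) -> integralOver h' b -> integralOver h b.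
Proof.
move=> hg [F Fmon F0]; exists (map_poly g F); first exact: monic_map.
by rewrite -map_poly_comp (eq_map_poly (g := h')).
Qed.

Lemma integralOver_trans (A A' B : comNzRingType) (h : {rmorphism A -> B})
    (h' : {rmorphism A' -> B}) b :
  integralOver h b -> (forall a, integralOver h' (h a)) -> integralOver h' b.
Proof.
move=> [F Fmon F0] hh'; apply: (mxpoly.integral_root_monic (p := map_poly h F)) => //.
  exact: monic_map.
by apply/mxpoly.integral_poly => i; rewrite coef_map /=.
Qed.

Lemma integralOver_exp (A B : comNzRingType) (h : {rmorphism A -> B}) b n :
  integralOver h b -> integralOver h (b ^+ n).
Proof.
move=> ib; elim: n => [|n IHn]; first exact: mxpoly.integral1.
by rewrite exprS; apply: mxpoly.integral_mul.
Qed.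

Lemma integralOver_sum (A B : comNzRingType) (h : {rmorphism A -> B}) I (r : seq I) F :
  (forall i, integralOver h (F i)) -> integralOver h (\sum_(i <- r) F i).
Proof.
move=> iF; apply: (big_ind (integralOver h)) => [|x y|i _].
- exact: mxpoly.integral0.
- exact: mxpoly.integral_add.
- exact: iF.
Qed.

Lemma integralOver_poly_ring (A A' B : comNzRingType)
    (h : {rmorphism {poly A} -> B}) (h' : {rmorphism A' -> B}) p :
  (forall a, integralOver h' (h a%:P)) -> integralOver h' (h 'X) ->
  integralOver h' (h p).
Proof.
move=> ia iX; rewrite rmorph_poly_sum; apply: integralOver_sum => i.
by apply: mxpoly.integral_mul => //; apply: integralOver_exp.
Qed.

End Integral.

(** * Polynomials in several variables *)

Section MultivariatePolynomials.
Local Open Scope ring_scope.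
Variable K : numClosedFieldType.

(** Iterated univariate polynomials keep pseudo-division available in the last
    variable, with an integral domain of coefficients. *)
Fixpoint mvpoly (d : nat) : idomainType :=
  if d is d'.+1 then {poly (mvpoly d')} else K.

Fixpoint mvpolyC (d : nat) : {rmorphism K -> mvpoly d} :=
  match d return {rmorphism K -> mvpoly d} with
  | 0 => (@idfun K) : {rmorphism K -> K}
  | d'.+1 => (@polyC (mvpoly d') \o mvpolyC d' : {rmorphism K -> {poly (mvpoly d')}})
  end.

Lemma mvpolyCS d c : mvpolyC d.+1 c = (mvpolyC d c)%:P. Proof. by []. Qed.

Lemma exists_nonroot (R : idomainType) (sR : {rmorphism K -> R}) (p : {poly R}) :
  p != 0 -> exists c, p.[sR c] != 0.
Proof.
move=> p0; apply/not_existsP => H.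
pose s : seq R := [seq sR (i%:R) | i <- iota 0 (size p)].
have us : uniq s.
  rewrite map_inj_uniq ?iota_uniq // => i j /fmorph_inj/eqP.
  by rewrite eqr_nat => /eqP.
have rs : all (root p) s.
  by apply/allP => _ /mapP[i _ ->]; apply/rootP/eqP/negPn/negP/H.
by have := max_poly_roots p0 rs us; rewrite size_map size_iota ltnn.
Qed.

Lemma noetherian_mv d : noetherian (mvpoly d).
Proof.
elim: d => [|d IHd]; first exact: noetherian_field.
exact: (noetherian_poly IHd).
Qed.

(** A parametrized curve through the point [phi] that is not contained in the
    zero set of [h]. Moving one coordinate at a time, only finitely many
    directions are bad. *)
Lemma mv_curve d (phi : {rmorphism mvpoly d -> K}) (h : mvpoly d) :
  (forall c, phi (mvpolyC d c) = c) -> h != 0 ->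
  exists psi : {rmorphism mvpoly d -> {poly K}},
    [/\ forall c, psi (mvpolyC d c) = c%:P, forall p, (psi p).[0] = phi p &
        psi h != 0].
Proof.
elim: d phi h => [|d IHd] phi h phiC h0.
  exists (@polyC K); split=> [//|p|]; last by rewrite polyC_eq0.
  by rewrite hornerC; apply/esym/phiC.
pose phi0 : {rmorphism mvpoly d -> K} := phi \o (@polyC (mvpoly d)).
have [||psi [psiC psi0 psih]] := IHd phi0 (lead_coef (h : {poly (mvpoly d)})).
- exact: phiC.
- by rewrite lead_coef_eq0.
pose w0 : {poly K} := (phi 'X)%:P.
pose w : {poly {poly K}} := 'X%:P * 'X + w0%:P.
have sw : size w = 2%N.
  by rewrite /w size_MXaddC polyC_eq0 polyX_eq0 /= size_polyC polyX_eq0.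
have [|u hu] := @exists_nonroot {poly K} (@polyC K) (map_poly psi (h : {poly (mvpoly d)}) \Po w).
  rewrite comp_poly2_eq0 // -lead_coef_eq0 lead_coef_map_eq //.
have uE : w.[u%:P] = 'X * u%:P + w0 by rewrite /w !hornerE.
exists (poly_ev psi ('X * u%:P + w0)); split=> [c|p|].
- by rewrite poly_evC; apply: psiC.
- rewrite (@rmorph_polyE _ _ phi phi0) // poly_evE.
  rewrite -/(horner_eval 0 _) -horner_map /= /horner_eval !hornerE.
  congr horner; apply/polyP => i.
  by rewrite !coef_map_id0 ?rmorph0 ?horner0 ?psi0.
- by rewrite poly_evE -uE -horner_comp.
Qed.

Lemma mv_point0 d : exists v : {rmorphism mvpoly d -> K}, forall c, v (mvpolyC d c) = c.
Proof.
elim: d => [|d [v vC]]; first by exists (@idfun K).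
by exists (poly_ev v 0) => c; rewrite mvpolyCS poly_evC.
Qed.

Lemma mv_nonroot d (h : mvpoly d) : h != 0 ->
  exists2 v : {rmorphism mvpoly d -> K}, (forall c, v (mvpolyC d c) = c) & v h != 0.
Proof.
move=> h0; have [v vC] := mv_point0 d.
have [psi [psiC _ /closed_nonrootP[c hc]]] := mv_curve vC h0.
by exists (horner_eval c \o psi) => // a; rewrite /= psiC /horner_eval hornerC.
Qed.

(** Nagata's change of variables: some automorphism fixing the last variable [T]
    turns [F] into a polynomial with constant leading coefficient in [T]. Write
    [F] as a polynomial in the previous variable [y]; by induction its leading
    coefficient can be assumed to have this property, and then [y -> y + T^N]
    makes it dominate as soon as [N] exceeds the degrees in [T]. *)
Lemma nagata_trick d (F : {poly (mvpoly d)}) : F != 0 ->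
  exists s t : {rmorphism {poly (mvpoly d)} -> {poly (mvpoly d)}},
    [/\ cancel s t, forall c, s (mvpolyC d c)%:P = (mvpolyC d c)%:P, s 'X = 'X &
        exists2 c, c != 0 & lead_coef (s F) = mvpolyC d c].
Proof.
elim: d F => [|d IHd] F F0.
  exists idfun, idfun; split=> //; exists (lead_coef F) => //.
  by rewrite lead_coef_eq0.
have sF0 : swapXY (F : {poly {poly (mvpoly d)}}) != 0 by rewrite swapXY_eq0.
have [s [t [sK sC sX [c c0 lc]]]] := IHd (lead_coef (swapXY (F : {poly {poly (mvpoly d)}})))
   ltac:(by rewrite lead_coef_eq0).
pose P : {poly {poly (mvpoly d)}} := map_poly s (swapXY (F : {poly {poly (mvpoly d)}})).
have sinj : injective s := can_inj sK.
have lP : lead_coef P = s (lead_coef (swapXY (F : {poly {poly (mvpoly d)}}))).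
  by rewrite /P lead_coef_map_inj ?rmorph0.
have P0 : P != 0 by rewrite -lead_coef_eq0 lP raddf_eq0 // lead_coef_eq0.
(* N bounds the sizes in T of all coefficients of P in y, so that the term of
   top degree in y has the strictly largest degree in T after substitution. *)
pose N := (sizeY P).
pose q : {poly {poly (mvpoly d)}} := 'X + ('X^N)%:P.
pose q' : {poly {poly (mvpoly d)}} := 'X - ('X^N)%:P.
pose s1 : {rmorphism {poly {poly (mvpoly d)}} -> {poly {poly (mvpoly d)}}} :=
  @swapXY (mvpoly d) \o (comp_poly q \o (map_poly s \o @swapXY (mvpoly d))).
pose t1 : {rmorphism {poly {poly (mvpoly d)}} -> {poly {poly (mvpoly d)}}} :=
  @swapXY (mvpoly d) \o (map_poly t \o (comp_poly q' \o @swapXY (mvpoly d))).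
exists s1, t1; split.
- move=> p; rewrite /t1 /s1 /= swapXYK -comp_polyA.
  have -> : q \Po q' = 'X.
    by rewrite /q comp_polyD comp_polyX comp_polyC /q' subrK.
  by rewrite comp_polyXr -map_poly_comp map_poly_id ?swapXYK // => x _ /=.
- move=> a; rewrite /s1 /= swapXY_polyC /= map_polyC /= map_polyC /= sC.
  by rewrite comp_polyC swapXY_polyC map_polyC.
- rewrite /s1 /= swapXY_X map_polyC /= sX comp_polyC swapXY_polyC.
  by rewrite map_polyX.
exists c => //.
pose Q : {poly {poly (mvpoly d)}} := 'X^N + 'X%:P.
have N0 : (0 < N)%N by rewrite lt0n /N sizeY_eq0.
have Qmon : Q \is monic.
  by rewrite monicE /Q lead_coefDl ?lead_coefXn // size_polyXn size_polyC polyX_eq0.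
have sQ : size Q = N.+1.
  by rewrite /Q size_polyDl size_polyXn // size_polyC polyX_eq0.
have -> : s1 F = \sum_(i < size P) (P`_i)^:P * Q ^+ i.
  rewrite /s1 /= -/P comp_polyE rmorph_sum; apply: eq_bigr => i _ /=.
  rewrite -mul_polyC rmorphM rmorphXn /= swapXY_polyC; congr (_ * _ ^+ _).
  by rewrite /q rmorphD /= swapXY_X swapXY_polyC map_polyXn addrC.
have sQi i : size (Q ^+ i) = (N * i).+1.
  by have := size_exp Q i; rewrite sQ /= => <-; rewrite prednK // size_poly_gt0 expf_neq0 // monic_neq0.
have sPi (p : {poly (mvpoly d)}) : size p^:P = size p by rewrite size_map_polyC.
rewrite (polySpred P0) big_ord_recr /= -lead_coefE.
have lPQ : lead_coef ((lead_coef P)^:P * Q ^+ (size P).-1) = mvpolyC d.+1 c.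
  by rewrite lead_coef_Mmonic ?monic_exp // lead_coef_map_inj ?rmorph0 ?lP ?lc //; exact: polyC_inj.
rewrite lead_coefDr //.
rewrite size_Mmonic ?monic_exp ?map_polyC_eq0 ?lead_coef_eq0 // sQi sPi addnS /=.
apply: (@leq_ltn_trans (N * (size P).-1)); last first.
  by rewrite -[X in (X < _)%N]add0n ltn_add2r size_poly_gt0 lead_coef_eq0.
apply: (leq_trans (size_sum _ _ _)); apply/bigmax_leqP => i _.
rewrite (leq_trans (size_polyMleq _ _)) // sQi sPi addnS /=.
by rewrite (@leq_trans (N * i.+1)) ?leq_mul // mulnS leq_add2r max_size_coefXY.
Qed.

End MultivariatePolynomials.

(** * Noether normalization *)

Section NoetherNormalization.
Local Open Scope ring_scope.
Variable K : numClosedFieldType.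

(** An algebraic relation between d + 1 elements makes them integral over the
    image of a polynomial ring in only d variables. *)
Lemma integral_over_fewer (B : comNzRingType) (sB : {rmorphism K -> B}) d
    (z : {rmorphism {poly (mvpoly K d)} -> B}) (F : {poly (mvpoly K d)}) :
  (forall c, z (mvpolyC K d c)%:P = sB c) -> F != 0 -> z F = 0 ->
  exists y : {rmorphism mvpoly K d -> B},
    (forall c, y (mvpolyC K d c) = sB c) /\ (forall p, integralOver y (z p)).
Proof.
move=> zC F0 zF; have [s [t [sK sC sX [c c0 lc]]]] := nagata_trick F0.
have zt p : z p = (z \o t) (s p) by rewrite /= sK.
pose y : {rmorphism mvpoly K d -> B} := (z \o t) \o @polyC (mvpoly K d).
exists y; split=> [a|p]; first by rewrite /y /= -sC sK zC.
rewrite zt; apply: integralOver_poly_ring => [a|]; first exact: (mxpoly.integral_id y).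
pose G := (mvpolyC K d c^-1) *: s F.
have cc : mvpolyC K d c^-1 * mvpolyC K d c = 1 by rewrite -rmorphM mulVf ?rmorph1.
exists G.
  rewrite monicE /G lead_coefE coefZ.
  have -> : size (mvpolyC K d c^-1 *: s F) = size (s F).
    by rewrite size_scale // fmorph_eq0 invr_eq0.
  by rewrite -lead_coefE lc cc.
apply/rootP; rewrite -(@rmorph_polyE _ _ (z \o t) y) //.
by rewrite /G -mul_polyC rmorphM /= sK zF mulr0.
Qed.

Theorem noether_normalization (B : comNzRingType) (sB : {rmorphism K -> B}) n
    (x : {rmorphism mvpoly K n -> B}) :
  (forall c, x (mvpolyC K n c) = sB c) ->
  exists d (y : {rmorphism mvpoly K d -> B}),
    [/\ (d <= n)%N, forall c, y (mvpolyC K d c) = sB c,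
        forall p, y p = 0 -> p = 0 & forall p, integralOver y (x p)].
Proof.
elim/ltn_ind: n x => -[|n] IHn x xC.
  exists 0%N, x; split=> // [p /eqP|p]; last exact: mxpoly.integral_id.
  by rewrite (@fmorph_eq0 K) => /eqP.
pose x0 : {rmorphism mvpoly K n -> B} := x \o (@polyC (mvpoly K n)).
have [d [y [dn yC yinj yint]]] := IHn n (ltnSn n) x0 xC.
pose t := x 'X; pose z := poly_ev y t.
have xint (A : comNzRingType) (h : {rmorphism A -> B}) p :
    (forall a, integralOver h (y a)) -> integralOver h t -> integralOver h (x p).
  move=> hy ht; apply: (integralOver_poly_ring (h := x)) => // a.
  exact: integralOver_trans (yint a) hy.
have [[F [F0 zF]]|nF] := pselect (exists F, F != 0 /\ z F = 0); last first.
  exists d.+1, z; split=> // [c|p zp|p].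
  - by rewrite /z poly_evC.
  - by apply/eqP; apply: contrapT => /negP p0; apply: nF; exists p.
  - apply: xint => [a|].
      by rewrite -(poly_evC y t); apply: (mxpoly.integral_id z).
    by rewrite -(poly_evX y t); apply: (mxpoly.integral_id z).
have [|y1 [y1C y1int]] := integral_over_fewer (sB := sB) _ F0 zF.
  by move=> c; rewrite /z poly_evC.
have [e [y2 [ed y2C y2inj y2int]]] := IHn d dn y1 y1C.
have zint p : integralOver y2 (z p) by apply: integralOver_trans (y1int p) y2int.
exists e, y2; split=> // [|p]; first by rewrite (leq_trans ed) // leqW.
apply: xint => [a|]; first by rewrite -(poly_evC y t); apply: zint.
by rewrite -(poly_evX y t); apply: zint.
Qed.

End NoetherNormalization.

(** * Gauss's lemma for polynomial rings *)

Section Gauss.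
Local Open Scope ring_scope.

(** Gauss's lemma without fraction fields: a factor of a monic polynomial over
    the fraction field of [R], cleared of denominators as [F], becomes monic
    over [R] after division by its leading coefficient. *)
Definition gauss (R : idomainType) : Prop :=
  forall (F H G : {poly R}) (m : R), m != 0 -> G \is monic -> F * H = m *: G ->
  forall i, exists u, F`_i = u * lead_coef F.

Lemma poly_scaleI (R : idomainType) (c : R) :
  c != 0 -> injective (GRing.scale c : {poly R} -> {poly R}).
Proof.
move=> c0 p q; rewrite -!mul_polyC => /mulfI; apply.
by rewrite polyC_eq0.
Qed.

Lemma coef_div_scale (R : idomainType) (a : R) (F : {poly R}) :
  (forall i, exists u, F`_i = a * u) -> exists F', F = a *: F'.
Proof.
move=> /choice[u uP]; exists (\poly_(i < size F) u i).
apply/polyP => i; rewrite coefZ coef_poly; case: ltnP => [_|sF]; first exact: uP.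
by rewrite mulr0 nth_default.
Qed.

(** A root z of [m] makes [F * H] vanish modulo ['X - z], so ['X - z] divides
    one of the two factors and can be cancelled. *)
Lemma gauss_poly_closed (K : closedFieldType) : gauss {poly K}.
Proof.
move=> F H G m; move: {2}(size m) (leqnn (size m)) => n.
elim: n m F H => [|n IHn] m F H sm m0 Gmon E i.
  by move: m0; rewrite -size_poly_eq0 -leqn0 sm.
have [sm1|sm1] := eqVneq (size m) 1%N.
  have /eqP/size_poly1P[c c0 mE] := sm1.
  have lE : lead_coef F * lead_coef H = c%:P.
    by rewrite -lead_coefM E lead_coefZ (monicP Gmon) mulr1 mE.
  have u1 : lead_coef F * lead_coef H * (c^-1)%:P = 1.
    by rewrite lE -polyCM mulfV.
  by exists (F`_i * lead_coef H * (c^-1)%:P); rewrite -[LHS]mulr1 -u1; ring.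
have /closed_rootP[z /factor_theorem[m' mE]] := sm1.
pose ev : {rmorphism {poly K} -> K} := horner_eval z.
have evdiv (P : {poly {poly K}}) : map_poly ev P = 0 -> exists P', P = ('X - z%:P) *: P'.
  move=> /polyP P0; apply: coef_div_scale => j.
  have /eqP/factor_theorem[u ->] : (P`_j).[z] = 0.
    by have := P0 j; rewrite coef_map coef0.
  by exists u; rewrite mulrC.
have m'0 : m' != 0 by apply: contraNneq m0 => m'0; rewrite mE m'0 mul0r.
have sm' : (size m' <= n)%N.
  by move: sm; rewrite mE size_Mmonic ?monicXsubC // size_XsubC addn2.
have Xz0 : 'X - z%:P != 0 :> {poly K} by rewrite polyXsubC_eq0.
have /eqP : map_poly ev F * map_poly ev H = 0.
  have evm : m.[z] = 0 by rewrite mE !hornerE subrr mulr0.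
  by rewrite -rmorphM E -mul_polyC rmorphM /= map_polyC /= /horner_eval evm mul0r.
rewrite mulf_eq0 => /orP[] /eqP/evdiv[P PE].
  have [|u uE] := IHn m' P H sm' m'0 Gmon _ i.
    apply: (poly_scaleI Xz0); rewrite scalerAl -PE E mE scalerA; congr (_ *: _).
    by rewrite mulrC.
  by exists u; rewrite PE coefZ lead_coefZ uE mulrCA.
apply: (IHn m' F P) => //; apply: (poly_scaleI Xz0).
by rewrite scalerAr -PE E mE scalerA mulrC.
Qed.

(** Differences of the constants in [K] are units, so the coefficients of a
    polynomial of degree n are [K]-combinations of n + 1 of its values. *)
Lemma poly_interpolation (K : numClosedFieldType) (R : idomainType)
    (sR : {rmorphism K -> R}) (l : R) (Q bad : {poly R}) :
  bad != 0 -> (forall c, bad.[sR c] != 0 -> exists u, Q.[sR c] = l * u) ->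
  exists Q', Q = l *: Q'.
Proof.
move: {2}(size Q) (leqnn (size Q)) => n.
elim: n Q bad => [|n IHn] Q bad sQ bad0 H.
  by exists 0; rewrite scaler0; apply/eqP; rewrite -size_poly_leq0.
have [c badc] := exists_nonroot sR bad0.
have /factor_theorem[Q1 Q1E] : root (Q - (Q.[sR c])%:P) (sR c).
  by rewrite /root !hornerE subrr.
have [u uE] := H c badc.
have [|||Q' Q'E] := IHn Q1 (bad * ('X - (sR c)%:P)).
- have [->|Q10] := eqVneq Q1 0; first by rewrite size_poly0.
  have : (size (Q1 * ('X - (sR c)%:P))%R <= n.+1)%N.
    by rewrite -Q1E (leq_trans (size_polyD _ _)) // geq_max sQ size_polyN size_polyC; case: eqP.
  by rewrite size_Mmonic ?monicXsubC // size_XsubC addn2.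
- by rewrite mulf_neq0 // polyXsubC_eq0.
- move=> c'; rewrite hornerM mulf_eq0 negb_or => /andP[badc']; rewrite !hornerE => cc'.
  have [u' u'E] := H c' badc'.
  have : (Q - (Q.[sR c])%:P).[sR c'] = l * (u' - u).
    by rewrite !hornerE u'E uE mulrBr.
  rewrite Q1E !hornerE -rmorphB => EE.
  exists ((u' - u) * sR ((c' - c)^-1)); rewrite mulrA -EE -mulrA -rmorphM mulfV ?rmorph1 ?mulr1 //.
  by move: cc'; rewrite -rmorphB fmorph_eq0.
exists (Q' * ('X - (sR c)%:P) + u%:P).
by rewrite scalerDr scalerAl -Q'E -Q1E -mul_polyC -polyCM -uE subrK.
Qed.

(** Specializing the coefficients in [R] to [K] reduces to one variable and shows
    that [l * b] is a multiple of the leading coefficient [a], where [l] is a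
    power of an element of [R]; specializing the variable to constants and
    interpolating then removes [l]. *)
Lemma gauss_poly (K : numClosedFieldType) (R : idomainType)
    (sR : {rmorphism K -> R}) :
  (forall r : R, r != 0 -> exists v : {rmorphism R -> K}, v r != 0) ->
  gauss R -> gauss {poly R}.
Proof.
move=> Rpts gR F H G m m0 Gmon E i.
have F0 : F != 0.
  apply: contraNneq m0 => F0; move: E; rewrite F0 mul0r => /esym/eqP.
  by rewrite -mul_polyC mulf_eq0 polyC_eq0 (negPf (monic_neq0 Gmon)) orbF.
set b := F`_i; set a := lead_coef F.
have a0 : a != 0 by rewrite lead_coef_eq0.
have := Pdiv.ComRing.rdivp_eq a b.
set l := lead_coef a ^+ _; set Q := Pdiv.CommonRing.rdivp _ _; set r := Pdiv.CommonRing.rmodp _ _ => bE.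
have l0 : l != 0 by rewrite expf_neq0 // lead_coef_eq0.
have r0 : r = 0.
  apply/eqP; apply: contrapT => /negP r0.
  have [|v] := Rpts (lead_coef a * lead_coef m * lead_coef r).
    by rewrite !mulf_neq0 // lead_coef_eq0.
  rewrite !rmorphM !mulf_eq0 !negb_or => /andP[/andP[va vm] vr].
  pose w : {rmorphism {poly R} -> {poly K}} := map_poly v.
  have wa : w a != 0 by rewrite -lead_coef_eq0 lead_coef_map_eq.
  have wm : w m != 0 by rewrite -lead_coef_eq0 lead_coef_map_eq.
  have wr : w r != 0 by rewrite -lead_coef_eq0 lead_coef_map_eq.
  have wlF : lead_coef (map_poly w F) = w a by rewrite lead_coef_map_eq.
  have [||u] := @gauss_poly_closed K (map_poly w F) (map_poly w H) (map_poly w G) (w m) wm _ _ i.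
  - exact: monic_map.
  - by rewrite -rmorphM E -mul_polyC rmorphM /= map_polyC /= mul_polyC.
  rewrite coef_map wlF -/b => uE.
  have : w a %| w r.
    have -> : w r = (v l *: u - w Q) * w a.
      rewrite mulrBl -scalerAl -uE -rmorphM; apply/eqP; rewrite eq_sym subr_eq addrC -rmorphD -bE.
      by rewrite /= map_polyZ.
    exact: dvdp_mull.
  move/(dvdp_leq wr); rewrite leqNgt => /negP; apply.
  rewrite (leq_ltn_trans (size_poly _ _)) // /w size_map_poly_id0 //.
  exact: Pdiv.CommonRing.ltn_rmodpN0.
have [|Q' Q'E] := @poly_interpolation K R sR l Q (a * m) (mulf_neq0 a0 m0).
  move=> c; rewrite hornerM mulf_eq0 negb_or => /andP[ac mc].
  pose w : {rmorphism {poly R} -> R} := horner_eval (sR c).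
  have wlF : lead_coef (map_poly w F) = w a by rewrite lead_coef_map_eq.
  have [||u] := gR (map_poly w F) (map_poly w H) (map_poly w G) (w m) mc _ _ i.
  - exact: monic_map.
  - by rewrite -rmorphM E -mul_polyC rmorphM /= map_polyC /= mul_polyC.
  rewrite coef_map wlF -/b => uE; exists u.
  apply: (mulIf ac); move: bE; rewrite r0 addr0 => /(congr1 w).
  rewrite -mul_polyC !rmorphM /= /horner_eval hornerC => <-.
  by rewrite -mulrA; congr (_ * _).
exists Q'; apply: (poly_scaleI l0); rewrite bE r0 addr0 Q'E.
by rewrite scalerAl.
Qed.

Lemma gauss_mv (K : numClosedFieldType) d : gauss (mvpoly K d).
Proof.
elim: d => [|d IHd].
  move=> F H G m m0 Gmon E i; exists (F`_i / lead_coef F).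
  rewrite divfK // lead_coef_eq0; apply: contraNneq m0 => F0; move: E.
  rewrite F0 mul0r => /esym/eqP.
  by rewrite -mul_polyC mulf_eq0 polyC_eq0 (negPf (monic_neq0 Gmon)) orbF.
apply: (gauss_poly (mvpolyC K d) _ IHd) => r r0.
by have [v _ vr] := mv_nonroot r0; exists v.
Qed.

End Gauss.

(** * Limits of points along ultrafilters *)

Section Limits.
Local Open Scope classical_set_scope.
Local Open Scope ring_scope.
Variables (K : numClosedFieldType) (T : Type) (U : set_system T).

Definition tends (u : T -> K) (c : K) : Prop :=
  forall e, 0 < e -> U [set t | `|u t - c| < e].

Section Filter.
Context {UF : ProperFilter U}.

Lemma tends_cst c : tends (fun=> c) c.
Proof. by move=> e e0; apply: filterE => t /=; rewrite subrr normr0. Qed.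

Lemma tends_eq u v c : (U [set t | u t = v t]) -> tends u c -> tends v c.
Proof. by move=> uv uc e /uc; apply: filterS2 uv => t /= ->. Qed.

Lemma tends_ext u v c : u =1 v -> tends u c -> tends v c.
Proof. by move=> uv; apply: tends_eq; apply: filterE => t; exact: uv. Qed.

Lemma tends_add u v c d :
  tends u c -> tends v d -> tends (fun t => u t + v t) (c + d).
Proof.
move=> uc vd e e0; have e2 : 0 < e / 2%:R by rewrite divr_gt0 // ltr0n.
apply: filterS2 (uc _ e2) (vd _ e2) => t /= ut vt.
rewrite opprD addrACA (le_lt_trans (ler_normD _ _)) //.
by rewrite [ltRHS](splitr e) ltrD.
Qed.

Lemma tends_mul u v c d :
  tends u c -> tends v d -> tends (fun t => u t * v t) (c * d).
Proof.
move=> uc vd e e0; pose k := 1 + `|c| + `|d|.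
have k0 : 0 < k by rewrite /k -addrA ltr_wpDr // addr_ge0.
pose n := e / k; have n0 : 0 < n by rewrite divr_gt0.
have eE : e = n + `|d| * n + `|c| * n.
  by rewrite -[LHS](divfK (lt0r_neq0 k0)) -/n /k; ring.
apply: filterS3 (uc _ n0) (uc _ ltr01) (vd _ n0) => t /= ut ut1 vt.
have -> : u t * v t - c * d =
  (u t - c) * (v t - d) + d * (u t - c) + c * (v t - d) by ring.
have le1 : `|(u t - c) * (v t - d) + d * (u t - c)| <= `|v t - d| + `|d| * n.
  rewrite (le_trans (ler_normD _ _)) // lerD // normrM.
    by rewrite ler_piMl // ltW.
  by rewrite ler_wpM2l // ltW.
rewrite (le_lt_trans (ler_normD _ _)) // eE ltr_leD //.
  by rewrite (le_lt_trans le1) // ltrD2r.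
by rewrite normrM ler_wpM2l // ltW.
Qed.

Lemma tends_sum (I : Type) (r : seq I) (u : I -> T -> K) (c : I -> K) :
  (forall i, tends (u i) (c i)) ->
  tends (fun t => \sum_(i <- r) u i t) (\sum_(i <- r) c i).
Proof.
move=> uc; elim: r => [|i r IHr].
  rewrite big_nil; apply: tends_ext (tends_cst 0) => t; by rewrite big_nil.
rewrite big_cons; apply: tends_ext (tends_add (uc i) IHr) => t.
by rewrite big_cons.
Qed.

Lemma tends_exp u c n : tends u c -> tends (fun t => u t ^+ n) (c ^+ n).
Proof.
move=> uc; elim: n => [|n IHn]; first by apply: tends_ext (tends_cst 1).
by rewrite exprS; apply: tends_ext (tends_mul uc IHn) => t; rewrite exprS.
Qed.

Lemma tends_opp u c : tends u c -> tends (fun t => - u t) (- c).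
Proof.
by move=> uc; rewrite -mulN1r; apply: tends_ext (tends_mul (tends_cst _) uc) => t; rewrite mulN1r.
Qed.

Lemma tends_poly (p : {poly K}) u c : tends u c -> tends (fun t => p.[u t]) p.[c].
Proof.
move=> uc; rewrite horner_coef; apply: (@tends_ext (fun t => \sum_(i < size p) p`_i * u t ^+ i)).
  by move=> t; rewrite horner_coef.
by apply: tends_sum => i; apply: tends_mul (tends_cst _) (tends_exp _ uc).
Qed.

Lemma tends_unique u c d : tends u c -> tends u d -> c = d.
Proof.
move=> uc ud; apply/eqP; rewrite -subr_eq0 -normr_eq0.
apply: contrapT => /negP cd0; have cd : 0 < `|c - d| by rewrite lt_def cd0 /=.
have cd2 : 0 < `|c - d| / 2%:R by rewrite divr_gt0 // ltr0n.
have [t [/= ut vt]] := filter_ex (filterI (uc _ cd2) (ud _ cd2)).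
have : `|c - d| < `|c - d| / 2%:R + `|c - d| / 2%:R.
  rewrite -{1}(subrKA (u t)) (le_lt_trans (ler_normD _ _)) //.
  by rewrite ltrD // distrC.
by rewrite -splitr ltxx.
Qed.

Lemma tends_bounded_mul u v M :
  U [set t | `|v t| <= M] -> tends u 0 -> tends (fun t => u t * v t) 0.
Proof.
move=> vM u0 e e0.
have [t0 t0M] := filter_ex vM.
have M1 : 0 < 1 + M by rewrite ltr_pwDl // (le_trans _ t0M).
have eM : 0 < e / (1 + M) by rewrite divr_gt0.
apply: filterS2 vM (u0 _ eM) => t /= vt; rewrite !subr0 => ut.
rewrite normrM -[ltRHS](divfK (lt0r_neq0 M1)).
apply: (@le_lt_trans _ _ (`|u t| * (1 + M))).
  by rewrite ler_wpM2l // (le_trans vt) // lerDr.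
by rewrite ltr_pM2r.
Qed.

End Filter.

(** Along an ultrafilter, a factor that does not tend to zero is bounded away
    from zero, hence can be cancelled. *)
Lemma ultra_prod0 (s : seq (T -> K)) : UltraFilter U ->
  tends (fun t => \prod_(f <- s) f t) 0 -> exists i, (i < size s)%N /\ tends (nth (fun=> 0) s i) 0.
Proof.
move=> UU; elim: s => [|f s IHs] s0.
  have s1 : tends (fun t => \prod_(f <- [::] : seq (T -> K)) f t) 1.
    by apply: tends_ext (tends_cst 1) => t; rewrite big_nil.
  have e10 : 1 = 0 :> K by exact: tends_unique s1 s0.
  by have := oner_neq0 K; rewrite e10 eqxx.
have [f0|nf0] := pselect (tends f 0); first by exists 0%N.
have [e [e0 nUe]] : exists e, 0 < e /\ ~ U [set t | `|f t - 0| < e].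
  by apply: contrapT => H; apply: nf0 => e e0; apply: contrapT => Ue; apply: H; exists e.
have Ue : U [set t | e <= `|f t|].
  have [//|] := in_ultra_setVsetC [set t | `|f t - 0| < e] UU.
  apply: filterS => t /= /negP; rewrite subr0 real_ltNge ?negbK ?normr_real //.
  exact: gtr0_real.
have [|i [si ti]] := IHs; last by exists i.+1.
have Ubd : U [set t | `|(f t)^-1| <= e^-1].
  apply: filterS Ue => t /= et; rewrite normfV lef_pV2 ?posrE //.
  exact: lt_le_trans et.
apply: tends_eq (tends_bounded_mul Ubd s0); apply: filterS Ue => t /= et.
rewrite big_cons mulrAC mulfV ?mul1r // -normr_gt0; exact: lt_le_trans et.
Qed.

(** If the value of a fixed split polynomial at [u] tends to zero, [u] converges
    to one of its roots. *)
Lemma ultra_root (r : seq K) (u : T -> K) : UltraFilter U ->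
  tends (fun t => \prod_(z <- r) (u t - z)) 0 -> exists z, tends u z.
Proof.
move=> UU r0.
have [|i [si ti]] := @ultra_prod0 [seq (fun t => u t - z) | z <- r] UU.
  by apply: tends_ext r0 => t; rewrite big_map.
rewrite size_map in si; exists r`_i.
rewrite (nth_map 0) // in ti.
rewrite -[r`_i]add0r; apply: tends_ext (tends_add ti (tends_cst r`_i)) => t.
by rewrite subrK.
Qed.

End Limits.

Section RootBound.
Local Open Scope ring_scope.

(** Cauchy's bound: a root larger than this would make the leading term dominate
    the sum of all the others. *)
Lemma monic_root_bound (K : numFieldType) (G : {poly K}) (m : nat -> K) x :
  G \is monic -> root G x -> (forall i, `|G`_i| <= m i) ->
  `|x| <= 1 + \sum_(i < (size G).-1) m i.
Proof.
move=> Gmon /rootP Gx Gm.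
have m0 i : 0 <= m i by apply: le_trans (Gm i).
set n := (size G).-1; set S := \sum_(i < n) m i.
have S0 : 0 <= S by apply: sumr_ge0.
rewrite real_leNgt ?normr_real ?ger0_real ?addr_ge0 //; apply/negP => xS.
have x1 : 1 < `|x| by apply: le_lt_trans xS; rewrite lerDl.
have sG : size G = n.+1 by rewrite prednK // size_poly_gt0 monic_neq0.
have : `|x| ^+ n <= S * `|x| ^+ n.-1.
  have -> : `|x| ^+ n = `|\sum_(i < n) G`_i * x ^+ i|.
    move: Gx; rewrite horner_coef sG big_ord_recr /= -[G`_n]/(G`_(size G).-1).
    rewrite -lead_coefE (monicP Gmon) mul1r => /eqP; rewrite addrC addr_eq0 => /eqP/(congr1 Num.norm).
    by rewrite normrN normrX.
  rewrite (le_trans (ler_norm_sum _ _ _)) // /S mulr_suml ler_sum // => i _.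
  rewrite normrM normrX ler_pM // ?exprn_ge0 //.
  by rewrite ler_weXn2l ?(ltW x1) // -ltnS prednK // (leq_ltn_trans _ (ltn_ord i)).
case: n @S S0 xS sG => [|n] S S0 xS sG.
  by rewrite /S big_ord0 mul0r expr0 ler10.
rewrite exprS /= ler_pM2r ?exprn_gt0 ?(lt_trans _ x1) // => xS'.
have : `|x| < `|x| by apply: le_lt_trans xS; rewrite (le_trans xS') // lerDr.
by rewrite ltxx.
Qed.

End RootBound.

Section PointLimit.
Local Open Scope classical_set_scope.
Local Open Scope ring_scope.

(** Properness of a finite morphism. Each element of [B] is a root of a monic
    polynomial whose coefficients converge, so its values are bounded and
    converge to a root of the limit polynomial; limits respect sums and
    products, hence define a point. *)
Lemma point_limit (K : numClosedFieldType) (A B : comNzRingType)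
    (h : {rmorphism A -> B}) (T : Type) (U : set_system T)
    (p : {rmorphism A -> K}) (q : T -> {rmorphism B -> K}) :
  UltraFilter U -> (forall b, integralOver h b) ->
  (forall a, tends U (fun t => q t (h a)) (p a)) ->
  exists q0 : {rmorphism B -> K},
    (forall a, q0 (h a) = p a) /\ (forall b, tends U (fun t => q t b) (q0 b)).
Proof.
move=> UU hint qp.
have ex b : exists c, tends U (fun t => q t b) c.
  have [F Fmon F0] := hint b.
  have [r rE] := closed_field_poly_normal (map_poly p F).
  rewrite (monicP (monic_map p Fmon)) scale1r in rE.
  apply: (ultra_root (r := r)).
  pose m i : K := `|p F`_i| + 1.
  have Um : U [set t | forall i : 'I_(size F), `|q t (h F`_i)| <= m i].
    apply: filter_forall => i; have := qp F`_i 1 ltr01; apply: filterS => t /= lt1.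
    rewrite -[q t _](subrK (p F`_i)) (le_trans (ler_normD _ _)) // addrC lerD //.
    exact: ltW.
  pose M := 1 + \sum_(i < (size F).-1) m i.
  have UM : U [set t | `|q t b| <= M].
    apply: filterS Um => t /= mt.
    pose G := map_poly (q t) (map_poly h F).
    have sG : size G = size F.
      by rewrite /G -map_poly_comp size_map_poly_id0 ?(monicP Fmon) ?rmorph1 ?oner_neq0.
    have := @monic_root_bound _ G m (q t b).
    rewrite sG; apply.
    - by rewrite !monic_map.
    - exact: rmorph_root.
    - move=> i; rewrite !coef_map /=; have [si|si] := ltnP i (size F).
        exact: (mt (Ordinal si)).
      by rewrite nth_default // !rmorph0 normr0 addr_ge0.
  have E t : \prod_(z <- r) (q t b - z) =
      \sum_(i < size F) (p F`_i - q t (h F`_i)) * q t b ^+ i.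
    transitivity ((map_poly p F).[q t b] - q t (map_poly h F).[b]).
      rewrite (rootP F0) rmorph0 subr0 rE horner_prod; apply: eq_bigr => z _.
      by rewrite !hornerE.
    rewrite -horner_map /= !(horner_coef_wide _ (n := size F)) ?size_poly //; last first.
      by rewrite (leq_trans (size_poly _ _)) // size_poly.
    by rewrite -sumrB; apply: eq_bigr => i _; rewrite !coef_map /= mulrBl.
  apply: (tends_ext (fun t => esym (E t))).
  rewrite [X in tends _ _ X](_ : 0 = \sum_(i < size F) 0); last by rewrite big1.
  apply: tends_sum => i.
  apply: (@tends_bounded_mul _ _ _ _ _ _ (M ^+ i)).
    by apply: filterS UM => t /= tM; rewrite normrX lerXn2r ?nnegrE // (le_trans _ tM).
  rewrite -(subrr (p F`_i)); apply: tends_add; first exact: tends_cst.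
  exact: tends_opp.
have [q0 q0P] := choice ex.
have q0E b c : tends U (fun t => q t b) c -> q0 b = c.
  by move=> bc; apply: tends_unique (q0P b) bc.
have qadd : zmod_morphism q0.
  move=> x y; apply: q0E.
  by apply: tends_ext (tends_add (q0P x) (tends_opp (q0P y))) => t; rewrite rmorphB.
have qmul : monoid_morphism q0.
  split=> [|x y]; apply: q0E.
    by apply: tends_ext (tends_cst 1) => t; rewrite rmorph1.
  by apply: tends_ext (tends_mul (q0P x) (q0P y)) => t; rewrite rmorphM.
pose qR : {rmorphism B -> K} := HB.pack q0 (GRing.isZmodMorphism.Build _ _ q0 qadd)
  (GRing.isMonoidMorphism.Build _ _ q0 qmul).
by exists qR; split=> // a; apply: q0E.
Qed.

End PointLimit.

(** * Integral extensions of polynomial rings *)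

Section Domains.
Local Open Scope classical_set_scope.
Local Open Scope ring_scope.
Variable K : numClosedFieldType.

Lemma punctured_ultrafilter : exists U : set_system K, UltraFilter U /\
  tends U id 0 /\ U [set s | s != 0].
Proof.
pose F : set_system K :=
  filter_from [set e : K | 0 < e] (fun e => [set s | s != 0 /\ `|s| < e]).
have FF : ProperFilter F.
  apply: filter_from_proper; last first.
    move=> e /= e0; exists (e / 2%:R); split.
      by rewrite lt0r_neq0 // divr_gt0 // ltr0n.
    by rewrite gtr0_norm ?divr_gt0 ?ltr0n // ltr_pdivrMr ?ltr0n // ltr_pMr // ltr1n.
  apply: filter_from_filter; first by exists 1 => /=; exact: ltr01.
  move=> e e' /= e0 e'0.
  have [ee'|e'e] := real_leP (gtr0_real e0) (gtr0_real e'0).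
    by exists e => //= s [s0 se]; split; split=> //; apply: lt_le_trans ee'.
  by exists e' => //= s [s0 se]; split; split=> //; apply: lt_trans e'e.
have [U [UU FU]] := ultraFilterLemma FF.
exists U; split=> //; split=> [e e0|]; apply: FU.
  by exists e => // s [_] /=; rewrite subr0.
by exists 1; [exact: ltr01|move=> s []].
Qed.

Lemma punctured_nonroot (U : set_system K) (p : {poly K}) :
  ProperFilter U -> tends U id 0 -> U [set s | s != 0] -> p != 0 ->
  U [set s | p.[s] != 0].
Proof.
move=> UF U0 Un p0; have [r ->] := closed_field_poly_normal p.
have lp : lead_coef p != 0 by rewrite lead_coef_eq0.
elim: r => [|z r IHr].
  by rewrite big_nil; apply: filterE => s /=; rewrite hornerZ hornerC mulr1.
rewrite big_cons; suff Uz : U [set s | s != z].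
  apply: filterS2 Uz IHr => s /= sz; rewrite !hornerZ hornerM !mulf_eq0 !negb_or.
  by move=> /andP[-> ->]; rewrite hornerXsubC subr_eq0 sz.
have [->//|z0] := eqVneq z 0.
have := U0 `|z|; rewrite normr_gt0 => /(_ z0); apply: filterS => s /=.
by rewrite subr0; apply: contraTneq => ->; rewrite ltxx.
Qed.

Section Domain.
Variables (B : comNzRingType).
Hypothesis dom : forall a b : B, a * b = 0 -> a = 0 \/ b = 0.

Lemma domain_neq0 a b : a != 0 -> a * b = 0 -> b = 0 :> B.
Proof. by move=> /eqP a0 /dom[]. Qed.

(** The constant term of an integral equation of [e] of least degree is a nonzero
    multiple of [e] coming from [A]. *)
Lemma integral_multiple (A : comNzRingType) (y : {rmorphism A -> B}) e :
  integralOver y e -> e != 0 -> exists h b, y h = e * b /\ y h != 0.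
Proof.
move=> [F Fmon /rootP F0] e0; move: {2}(size F) (leqnn (size F)) => n.
elim: n F Fmon F0 => [|n IHn] F Fmon F0 sF.
  by have := monic_neq0 Fmon; rewrite -size_poly_eq0 -leqn0 sF.
move: Fmon F0 sF; elim/poly_ind: F => [|F c _]; first by move/monic_neq0; rewrite eqxx.
have [->|Fn0] := eqVneq F 0.
  rewrite mul0r add0r => /monicP; rewrite lead_coefC => ->.
  by rewrite rmorph1 hornerC => /eqP; rewrite oner_eq0.
move=> Fmon; rewrite rmorphD rmorphM /= map_polyX map_polyC /= hornerD hornerMX hornerC => F0.
rewrite size_MXaddC (negPf Fn0) /= ltnS => sF.
have [yc|yc] := eqVneq (y c) 0; last first.
  exists c, (- (map_poly y F).[e]); split=> //.
  by apply/eqP; rewrite mulrN -addr_eq0 addrC mulrC F0.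
apply: (IHn F) => //.
  move: Fmon; rewrite !monicE lead_coefDl ?lead_coefMX // size_mulX // size_polyC.
  by rewrite ltnS; case: eqP => //=; rewrite size_poly_gt0.
by apply: (domain_neq0 e0); move: F0; rewrite yc addr0 mulrC.
Qed.

(** The monic generator exists because polynomial rings are integrally closed:
    an [F1] of least degree in the kernel divides, up to a scalar, an integral
    equation [G0], so Gauss's lemma applies to [F1]. *)
Lemma minimal_polynomial d (y : {rmorphism mvpoly K d -> B}) z :
  (forall p, y p = 0 -> p = 0) -> integralOver y z ->
  exists F : {poly (mvpoly K d)}, [/\ F \is monic, poly_ev y z F = 0 &
    forall G, poly_ev y z G = 0 -> exists H, G = H * F].
Proof.
move=> yinj [G0 G0mon G0z].
have G0z' : poly_ev y z G0 = 0 by rewrite poly_evE; exact/rootP.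
pose P n := `[< exists F, [/\ F != 0, poly_ev y z F = 0 & size F = n] >].
have exP : exists n, P n.
  exists (size G0); apply/asboolP; exists G0; split=> //; first exact: monic_neq0.
case: (ex_minnP exP) => n /asboolP[F1 [F10 F1z sF1]] nmin.
have small r : poly_ev y z r = 0 -> (size r < size F1)%N -> r = 0.
  move=> rz sr; apply/eqP; apply: contrapT => /negP r0.
  have : P (size r) by apply/asboolP; exists r.
  by move/nmin; rewrite -sF1 leqNgt sr.
have lF1 : lead_coef F1 != 0 by rewrite lead_coef_eq0.
have ylF1 : y (lead_coef F1) != 0 by apply: contra_neq lF1 => /yinj.
have [F F1E] : exists F, F1 = lead_coef F1 *: F.
  apply: coef_div_scale => i.
  have := Pdiv.ComRing.rdivp_eq F1 G0; set k := _ ^+ _; set H := Pdiv.CommonRing.rdivp _ _.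
  set r := Pdiv.CommonRing.rmodp _ _ => E.
  have r0 : r = 0.
    apply: small; last exact: Pdiv.CommonRing.ltn_rmodpN0.
    have : poly_ev y z (k *: G0) = 0 
      by rewrite -mul_polyC rmorphM G0z' mulr0.
    by rewrite E rmorphD rmorphM F1z mulr0 add0r.
  have [|//||u ->] := @gauss_mv K d F1 H G0 k _ _ _ i; first by rewrite expf_neq0.
    by rewrite E r0 addr0 mulrC.
  by exists u; rewrite mulrC.
have Fmon : F \is monic.
  have := congr1 lead_coef F1E; rewrite lead_coefZ -{1}[lead_coef F1]mulr1.
  by move/(mulfI lF1)/esym/monicP.
have Fz : poly_ev y z F = 0.
  apply: (domain_neq0 ylF1); have := F1z; rewrite {1}F1E -mul_polyC rmorphM.
  by rewrite poly_evC.
exists F; split=> // G Gz; exists (Pdiv.CommonRing.rdivp G F).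
have E := Pdiv.RingMonic.rdivp_eq Fmon G.
rewrite {1}E [X in _ + X]small ?addr0 //.
  by move: Gz; rewrite {1}E rmorphD rmorphM Fz mulr0 add0r.
rewrite [X in (_ < X)%N](_ : _ = size F); last by rewrite F1E -mul_polyC size_Cmul.
by apply: Pdiv.CommonRing.ltn_rmodpN0; exact: monic_neq0.
Qed.

End Domain.

(** Finiteness of the fibres: an integral element takes finitely many values on
    the points over [p]. *)
Lemma integral_values (A B : comNzRingType) (y : {rmorphism A -> B})
    (p : {rmorphism A -> K}) b :
  integralOver y b -> exists r : seq K, forall q : {rmorphism B -> K},
    (forall a, q (y a) = p a) -> q b \in r.
Proof.
move=> [F Fmon Fb]; have [r rE] := closed_field_poly_normal (map_poly p F).
rewrite (monicP (monic_map p Fmon)) scale1r in rE.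
exists r => q qy; rewrite -root_prod_XsubC -rE.
have -> : map_poly p F = map_poly q (map_poly y F).
  by rewrite -map_poly_comp; apply: eq_map_poly => a /=; rewrite qy.
exact: rmorph_root.
Qed.

(** A linear form in the generators that vanishes at [q] and at no other point of
    its fibre: the generators take finitely many values on the fibre, so a
    generic combination works. *)
Lemma separating_element (A B : comNzRingType) (sB : {rmorphism K -> B}) n
    (x : {rmorphism mvpoly K n -> B}) (y : {rmorphism A -> B})
    (q : {rmorphism B -> K}) :
  (forall c, x (mvpolyC K n c) = sB c) -> (forall c, q (sB c) = c) ->
  (forall b, integralOver y b) ->
  exists z, q z = 0 /\ forall q' : {rmorphism B -> K},
    (forall c, q' (sB c) = c) -> (forall a, q' (y a) = q (y a)) -> q' z = 0 ->
    forall p, q' (x p) = q (x p).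
Proof.
move=> xC qC yint; elim: n x xC => [|n IHn] x xC.
  exists 0; split=> [|q' q'C _ _ p]; first exact: rmorph0.
  by rewrite (xC p) q'C qC.
pose x0 : {rmorphism mvpoly K n -> B} := x \o @polyC (mvpoly K n).
have [z0 [qz0 z0P]] := IHn x0 xC.
pose w := x 'X - sB (q (x 'X)).
have qw : q w = 0 by rewrite rmorphB qC subrr.
pose p0 : {rmorphism A -> K} := q \o y.
have [rz rzP] := integral_values p0 (yint z0).
have [rw rwP] := integral_values p0 (yint w).
(* f g has l as a root exactly when the nonzero pair g of values is killed by
   the combination with coefficient l. *)
pose f (g : K * K) : {poly K} := if (g == 0) then 1 else (g.2)%:P * 'X + (g.1)%:P.
have [|l lP] := @exists_nonroot K K (@idfun K) (\prod_(g <- [seq (g, g') | g <- rz, g' <- rw]) f g).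
  rewrite prodf_seq_neq0; apply/allP => g _; apply/implyP => _.
  rewrite /f; have [_|g0] := eqVneq g 0; first exact: oner_neq0.
  rewrite -size_poly_eq0 size_MXaddC polyC_eq0; case: ifP => // /andP[/eqP g2 /eqP g1].
  by case: g g0 g1 g2 => a b g0 /= a0 b0; rewrite a0 b0 eqxx in g0.
exists (z0 + w * sB l); split=> [|q' q'C q'y]; first by rewrite rmorphD rmorphM qz0 qw mul0r addr0.
rewrite rmorphD rmorphM q'C => q'z.
have /eqP [q'z0 q'w] : (q' z0, q' w) == 0 :> K * K.
  apply: contrapT => /negP g0.
  have : (q' z0, q' w) \in [seq (g, g') | g <- rz, g' <- rw].
    by apply: allpairs_f; [apply: rzP|apply: rwP].
  move: lP; rewrite horner_prod prodf_seq_neq0 => /allP/[apply].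
  by rewrite /f (negPf g0) !hornerE addrC q'z eqxx.
move=> p; have q'x : q' (x 'X) = q (x 'X).
  by move/eqP: q'w; rewrite rmorphB q'C subr_eq0 => /eqP.
have E (r : {rmorphism B -> K}) :
  r (x p) = \sum_(i < size (p : {poly (mvpoly K n)})) r (x0 p`_i) * r (x 'X) ^+ i.
  exact: (@rmorph_poly_sum (mvpoly K n) K (r \o x)).
rewrite (E q') (E q).
apply: eq_bigr => i _ /=; rewrite q'x; congr (_ * _).
exact: (z0P q' q'C q'y q'z0).
Qed.

End Domains.

(** * Euclidean density and the Nullstellensatz *)

Section Density.
Local Open Scope classical_set_scope.
Local Open Scope ring_scope.
Variable K : numClosedFieldType.

(** Points of an irreducible variety avoiding a proper closed subset come
    arbitrarily near to any given point; the construction is explained at the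
    top. Uniqueness of [z] within the fibre of [q] is what identifies the limit
    of the lifted points. *)
Lemma points_near_in_domain (B : comNzRingType) (sB : {rmorphism K -> B}) n
    (x : {rmorphism mvpoly K n -> B}) (q : {rmorphism B -> K}) (e : B) :
  (forall a b : B, a * b = 0 -> a = 0 \/ b = 0) ->
  (forall c, x (mvpolyC K n c) = sB c) -> (forall b, exists p, x p = b) ->
  (forall c, q (sB c) = c) -> e != 0 ->
  exists (U : set_system K) (qs : K -> {rmorphism B -> K}),
    [/\ UltraFilter U, forall s c, qs s (sB c) = c,
        forall b, tends U (fun s => qs s b) (q b) &
        U [set s | qs s e != 0]].
Proof.
move=> dom xC xS qC e0.
have [d [y [_ yC yinj xint]]] := noether_normalization xC.
have yint b : integralOver y b by have [p <-] := xS b; apply: xint.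
have [h [b0 [yh h0]]] := integral_multiple dom (yint e) e0.
pose phi : {rmorphism mvpoly K d -> K} := q \o y.
have phiC c : phi (mvpolyC K d c) = c by rewrite /phi /= yC qC.
have hn0 : h != 0 by apply: contraNneq h0 => ->; rewrite rmorph0.
have [psi [psiC psi0 psih]] := mv_curve phiC hn0.
have [z [qz zP]] := separating_element xC qC yint.
have [F [Fmon Fz Fker]] := minimal_polynomial dom yinj (yint z).
pose psis s : {rmorphism mvpoly K d -> K} := horner_eval s \o psi.
have psisE s p : psis s p = (psi p).[s] by [].
have [U [UU [U0 Un0]]] := punctured_ultrafilter K.
have psis_lim p : tends U (fun s => psis s p) (phi p).
  by rewrite -psi0; apply: (@tends_poly K K U _ (psi p) id 0).
have /choice[rts rtsE] s : exists r, map_poly (psis s) F = \prod_(z <- r) ('X - z%:P).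
  have [r rE] := closed_field_poly_normal (map_poly (psis s) F).
  by exists r; rewrite {1}rE (monicP (monic_map _ Fmon)) scale1r.
pose N := (size F).-1.
have sizer s : size (rts s) = N.
  have := congr1 (fun p : {poly K} => (size p).-1) (rtsE s).
  by rewrite size_prod_XsubC /= size_map_poly_id0 // (monicP Fmon) rmorph1 oner_neq0.
(* The constant term of F along the curve is, up to sign, the product of its
   roots, and tends to zero; hence so does one of the roots. *)
have [|i [iN ri]] := @ultra_prod0 K K U [seq (fun s => - (rts s)`_i) | i <- iota 0 N] UU.
  have : tends U (fun s => psis s F`_0) 0.
    have := psis_lim F`_0; suff -> : phi F`_0 = 0 by [].
    have : q (poly_ev y z F) = 0 by rewrite Fz rmorph0.
    by rewrite poly_evE -horner_map qz /= horner_coef0 !coef_map.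
  apply: tends_ext => s; rewrite big_map.
  have -> : psis s F`_0 = (map_poly (psis s) F).[0].
    by rewrite horner_coef0 coef_map.
  rewrite (rtsE s) horner_prod (big_nth 0) sizer /index_iota subn0.
  by apply: eq_bigr => j _; rewrite !hornerE.
rewrite size_map size_iota in iN.
pose r s := (rts s)`_i.
have r0 : tends U r 0.
  move: ri; rewrite (nth_map 0%N) ?size_iota // nth_iota // add0n => /tends_opp.
  by rewrite oppr0; apply: tends_ext => s; rewrite opprK.
have Fr s : (map_poly (psis s) F).[r s] = 0.
  by apply/rootP; rewrite (rtsE s) root_prod_XsubC mem_nth // sizer.
have ex s : exists q' : {rmorphism B -> K}, (forall p, q' (y p) = psis s p) /\ q' z = r s.
  have int2 b : integralOver (poly_ev y z) b.
    apply: (integralOver_base (g := @polyC (mvpoly K d)) (h' := y)) => // a.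
    exact: poly_evC.
  have id0 : is_ideal [set 0 : B].
    by split=> //= [a b -> ->|a b ->]; rewrite ?addr0 ?mulr0.
  have [|a /Fker[H ->]|q' [q'h _]] := @lying_over K _ _ (@polyC (mvpoly K d) \o mvpolyC K d)
    (poly_ev y z) _ (poly_ev (psis s) (r s)) int2 id0.
  - by move=> c; rewrite [LHS]poly_evC psisE psiC hornerC.
  - have F0 : poly_ev (psis s) (r s) F = 0 := Fr s.
    by rewrite rmorphM F0 mulr0.
  exists q'; split=> [p|]; first by rewrite -(poly_evC y z) q'h poly_evC.
  by rewrite -[in LHS](poly_evX y z) q'h poly_evX.
have [qs qsP] := choice ex.
have qsC s c : qs s (sB c) = c.
  by have [H _] := qsP s; rewrite -yC H psisE psiC hornerC.
have [|q0 [q0y q0lim]] := @point_limit K _ _ y K U phi qs UU yint.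
  move=> a; apply: tends_ext (psis_lim a) => s.
  by have [-> _] := qsP s.
have q0q b : q0 b = q b.
  have [p <-] := xS b; apply: zP => [c||].
  - by rewrite -yC q0y phiC.
  - exact: q0y.
  - apply: tends_unique (q0lim z) _; apply: tends_ext r0 => s.
    by have [_ ->] := qsP s.
exists U, qs; split=> // [b|]; first by rewrite -q0q.
apply: filterS (punctured_nonroot _ U0 Un0 psih) => s /=.
apply: contra_neq => qe; have [qsy _] := qsP s.
by rewrite -psisE -qsy yh rmorphM qe mul0r.
Qed.

(** The irreducible component singled out by [prime_colon_ideal], as a domain
    [D]. *)
Lemma prime_quotient (S : comNzRingType) (sS : {rmorphism K -> S}) n
    (x : {rmorphism mvpoly K n -> S}) (J M : set S) :
  (forall c, x (mvpolyC K n c) = sS c) -> (forall b, exists p, x p = b) ->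
  is_ideal J -> M 1 -> (forall a b, M a -> M b -> M (a * b)) ->
  (forall a, M a -> ~ J a) ->
  exists s (D : comNzRingType) (h : {rmorphism S -> D}),
    [/\ forall a b : D, a * b = 0 -> a = 0 \/ b = 0, forall d, exists a, h a = d,
        forall a, h a = 0 <-> J (a * s) & forall a, M a -> ~ J (a * s)].
Proof.
move=> xC xS idJ M1 MM MJ; have [J0 JD JM] := idJ.
have nS : noetherian S := noetherian_surj xS (@noetherian_mv K n).
have [s [sM sprime]] := prime_colon_ideal nS idJ M1 MM MJ.
have idp : is_ideal [set a | J (a * s)].
  split=> [|a b|a b] /=; first by rewrite mul0r.
    by rewrite mulrDl; apply: JD.
  by rewrite -mulrA; apply: JM.
have [D [h [hS h0]]] := ideal_quotient idp (sM 1 M1).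
exists s, D, h; split=> // d1 d2.
have [a <-] := hS d1; have [b <-] := hS d2.
by rewrite -rmorphM h0 /= => /sprime[/h0|/h0]; [left|right].
Qed.

Lemma factor_point (S D : comNzRingType) (h : {rmorphism S -> D})
    (q : {rmorphism S -> K}) :
  (forall d, exists a, h a = d) -> (forall a, h a = 0 -> q a = 0) ->
  exists q' : {rmorphism D -> K}, forall a, q' (h a) = q a.
Proof.
move=> hS hq; have [g gP] := choice hS.
pose q' d := q (g d).
have q'h a : q' (h a) = q a.
  apply/eqP; rewrite -subr_eq0 -rmorphB; apply/eqP/hq.
  by rewrite rmorphB gP subrr.
have qadd : zmod_morphism q'.
  by move=> a b; rewrite -(gP a) -(gP b) -rmorphB !q'h rmorphB.
have qmul : monoid_morphism q'.
  split=> [|a b]; first by rewrite -(rmorph1 h) q'h rmorph1.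
  by rewrite -(gP a) -(gP b) -rmorphM !q'h rmorphM.
pose qR : {rmorphism D -> K} := HB.pack q' (GRing.isZmodMorphism.Build _ _ q' qadd)
  (GRing.isMonoidMorphism.Build _ _ q' qmul).
by exists qR.
Qed.

(** The set [I] of denominators cuts out a dense open subset of the zero set of
    [J]. Restricting to a component through [q] on which some element of [I]
    does not vanish reduces to a domain. *)
Theorem zariski_dense_euclidean (S : comNzRingType) (sS : {rmorphism K -> S}) n
    (x : {rmorphism mvpoly K n -> S}) (J I : set S) (q : {rmorphism S -> K}) :
  (forall c, x (mvpolyC K n c) = sS c) -> (forall b, exists p, x p = b) ->
  is_ideal J -> (forall a, J (a * a) -> J a) ->
  (forall c, ~ J c -> exists2 e, I e & ~ J (e * c)) ->
  (forall c, q (sS c) = c) -> (forall a, J a -> q a = 0) ->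
  exists (U : set_system K) (qs : K -> {rmorphism S -> K}),
    [/\ UltraFilter U, forall s c, qs s (sS c) = c, forall s a, J a -> qs s a = 0,
        forall b, tends U (fun s => qs s b) (q b) &
        U [set s | exists2 e, I e & qs s e != 0]].
Proof.
move=> xC xS idJ Jrad Idense qC qJ; have [_ _ JM] := idJ.
pose M := [set a | q a != 0].
have [||a /= qa /qJ qa0|s [D [h [dom hS h0 sM]]]] := @prime_quotient _ _ _ _ J M xC xS idJ.
- by rewrite /M /= rmorph1 oner_neq0.
- by move=> a b; rewrite /M /= rmorphM => qa qb; rewrite mulf_neq0.
- by move: qa; rewrite /M /= qa0 eqxx.
have sJ : ~ J s by rewrite -[s]mul1r; apply: sM; rewrite /M /= rmorph1 oner_neq0.
have [e Ie es] := Idense s sJ.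
have he : h e != 0 by apply/eqP => /h0.
have hq a : h a = 0 -> q a = 0.
  move=> /h0 Jas; apply/eqP; apply: contrapT => /negP qa.
  exact: (sM a qa).
have [q' q'h] := factor_point hS hq.
have [|||U [qs [UU qsC qslim qse]]] :=
  @points_near_in_domain D (h \o sS) n (h \o x) q' (h e) dom _ _ _ he.
- by move=> c; rewrite /= xC.
- by move=> d; have [a <-] := hS d; have [p <-] := xS a; exists p.
- by move=> c; rewrite /= q'h.
exists U, (fun s => qs s \o h); split=> //.
- by move=> t a Ja; rewrite /= (_ : h a = 0) ?rmorph0 //; apply/h0; rewrite mulrC; apply: JM.
- by move=> b; rewrite -q'h; exact: qslim.
- by apply: filterS qse => t /= qe; exists e.
Qed.

(** On a component where [c] does not vanish, Noether normalization provides a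
    multiple of [c] that is a polynomial; lift a point where it is nonzero. *)
Theorem nullstellensatz (S : comNzRingType) (sS : {rmorphism K -> S}) n
    (x : {rmorphism mvpoly K n -> S}) (c : S) :
  (forall c, x (mvpolyC K n c) = sS c) -> (forall b, exists p, x p = b) ->
  (forall (a : S) m, a ^+ m = 0 -> a = 0) -> c != 0 ->
  exists2 q : {rmorphism S -> K}, (forall c, q (sS c) = c) & q c != 0.
Proof.
move=> xC xS red c0.
have id0 : is_ideal [set 0 : S].
  by split=> //= [a b -> ->|a b ->]; rewrite ?addr0 ?mulr0.
pose M := [set a | exists m, a = c ^+ m].
have [||_ [m ->] /= /red/eqP|s [D [h [dom hS h0 sM]]]] := @prime_quotient _ _ _ _ _ M xC xS id0.
- by exists 0%N.
- by move=> _ _ [k ->] [l ->]; exists (k + l)%N; rewrite exprD.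
- exact/negP.
have hc : h c != 0.
  by apply/eqP => /h0 /=; apply: (sM c); exists 1%N.
pose hx : {rmorphism mvpoly K n -> D} := h \o x.
have [|d [y [_ yC yinj xint]]] := @noether_normalization K D (h \o sS) n hx.
  by move=> a; rewrite /= xC.
have yint b : integralOver y b.
  by have [a <-] := hS b; have [p <-] := xS a; apply: xint.
have [g [b0 [yg g0]]] := integral_multiple dom (yint (h c)) hc.
have gn0 : g != 0 by apply: contraNneq g0 => ->; rewrite rmorph0.
have [v vC vg] := mv_nonroot gn0.
have idD0 : is_ideal [set 0 : D].
  by split=> //= [a b -> ->|a b ->]; rewrite ?addr0 ?mulr0.
have [|q [qy _]] := @lying_over K _ _ (mvpolyC K d) y _ v yint idD0 vC.
  by move=> a /= /yinj ->; rewrite rmorph0.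
exists (q \o h) => [a|]; first by rewrite /= -[h _]/((h \o sS) a) -yC qy vC.
by apply: contra_neq vg => /= qc; rewrite -qy yg rmorphM qc mul0r.
Qed.

End Density.

(** * Rational functions and closed graphs *)

Section Graphs.
Local Open Scope classical_set_scope.
Local Open Scope ring_scope.
Variables (K : numClosedFieldType) (A : comNzRingType) (P : Type).
Variable ev : P -> {rmorphism A -> K}.

Definition graph_ideal (f : P -> K) : set {poly A} :=
  [set G | forall p, poly_ev (ev p) (f p) G = 0].

Definition closed_graph (f : P -> K) : Prop :=
  forall p t, (forall G, graph_ideal f G -> poly_ev (ev p) t G = 0) -> t = f p.

Definition denominators (f : P -> K) : set A :=
  [set e | exists a, forall p, ev p e * f p = ev p a].

(** Density of the domain of [f] in algebraic terms: no nonzero [c] annihilates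
    the ideal of denominators. *)
Definition densely_fractional (f : P -> K) : Prop :=
  forall c, c != 0 -> exists2 d, c * d != 0 & denominators f (c * d).

(** Euclidean continuity as preservation of limits along ultrafilters; points
    converge when the values of all regular functions do. *)
Definition ultra_continuous (f : P -> K) : Prop :=
  forall p (T : Type) (U : set_system T) (qs : T -> P), UltraFilter U ->
    (forall a, tends U (fun t => ev (qs t) a) (ev p a)) ->
    tends U (fun t => f (qs t)) (f p).

Lemma graph_idealP f : is_ideal (graph_ideal f).
Proof.
split=> [p|a b Ja Jb p|a b Jb p]; first exact: rmorph0.
  by rewrite rmorphD Ja Jb addr0.
by rewrite rmorphM Jb mulr0.
Qed.

Variables (sA : {rmorphism K -> A}) (n : nat) (x : {rmorphism mvpoly K n -> A}).
Hypothesis xC : forall c, x (mvpolyC K n c) = sA c.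
Hypothesis xS : forall a, exists g, x g = a.
Hypothesis red : forall (a : A) m, a ^+ m = 0 -> a = 0.
Hypothesis evC : forall p c, ev p (sA c) = c.
Hypothesis ev_point : forall q : {rmorphism A -> K}, (forall c, q (sA c) = c) ->
  exists p, forall a, ev p a = q a.

Lemma point_nonzero c : c != 0 -> exists p, ev p c != 0.
Proof.
move=> c0; have [q qC qc] := nullstellensatz xC xS red c0.
by have [p pE] := ev_point qC; exists p; rewrite pE.
Qed.

Lemma tends_poly_ev (T : Type) (U : set_system T) {UF : ProperFilter U} (q : T -> {rmorphism A -> K})
    (u : T -> K) (q0 : {rmorphism A -> K}) t0 (G : {poly A}) :
  (forall a, tends U (fun t => q t a) (q0 a)) -> tends U u t0 ->
  tends U (fun t => poly_ev (q t) (u t) G) (poly_ev q0 t0 G).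
Proof.
move=> qlim ulim.
have E (r : {rmorphism A -> K}) v : poly_ev r v G = \sum_(i < size G) r G`_i * v ^+ i.
  by rewrite rmorph_poly_sum; apply: eq_bigr => i _; rewrite poly_evC poly_evX.
rewrite E; apply: (tends_ext (fun t => esym (E (q t) (u t)))).
by apply: tends_sum => i; apply: tends_mul (qlim _) (tends_exp _ ulim).
Qed.

(** Euclidean density is used twice: on the zero set of the relations of the
    graph, and before that on the variety itself, to know that a relation valid
    where [f] is a fraction is valid everywhere. *)
Lemma fractional_closed_graph f :
  densely_fractional f -> ultra_continuous f -> closed_graph f.
Proof.
move=> frac cont p0 t0 Jt0.
pose I := denominators f.
have id0 : is_ideal [set 0 : A].
  by split=> //= [a b -> ->|a b ->]; rewrite ?addr0 ?mulr0.
have Idense c : ~ [set 0 : A] c -> exists2 e, I e & ~ [set 0 : A] (e * c).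
  move=> /= /eqP c0; have [d cd Icd] := frac c c0; exists (c * d) => //= E.
  have /eqP := red (a := c * d) (m := 2) ltac:(by rewrite expr2 mulrA E mul0r).
  exact/negP.
have JU G : (forall p e, I e -> ev p e != 0 -> poly_ev (ev p) (f p) G = 0) ->
    graph_ideal f G.
  move=> G0 p.
  have [||U [qs [UU qsC _ qslim qse]]] := zariski_dense_euclidean xC xS id0 _ Idense (evC p).
  - by move=> a /= aa; apply: (red (m := 2)); rewrite expr2.
  - by move=> a ->; rewrite rmorph0.
  have [ps psE] := choice (fun s => ev_point (qsC s)).
  have pslim a : tends U (fun s => ev (ps s) a) (ev p a).
    by apply: tends_ext (qslim a) => s; rewrite psE.
  apply: (tends_unique (tends_poly_ev G pslim (cont _ _ _ _ UU pslim))).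
  apply: tends_eq (tends_cst 0).
  apply: filterS qse => s [e Ie qe]; apply/esym/(G0 _ e) => //.
  by rewrite psE.
have Jid := graph_idealP f.
pose I' := [set G : {poly A} | exists2 e, I e & G = e%:P].
pose px : {rmorphism mvpoly K n.+1 -> {poly A}} := map_poly x.
have pxS G : exists g, px g = G.
  have /choice[u uE] i := xS G`_i.
  exists (\poly_(i < size G) u i : {poly (mvpoly K n)}); apply/polyP => i.
  rewrite coef_map /= coef_poly; case: ltnP => [_|sG]; first exact: uE.
  by rewrite rmorph0 nth_default.
have [||G JG|c|G|U [qs [UU qsC qsJ qslim qse]]] :=
  @zariski_dense_euclidean K {poly A} (@polyC A \o sA) n.+1 px (graph_ideal f) I'
    (poly_ev (ev p0) t0) _ pxS Jid.
- by move=> c; rewrite /px /= map_polyC /= xC.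
- by move=> G JG p; apply/eqP; have /eqP := JG p; rewrite rmorphM mulf_eq0 orbb.
- have [p [e [Ie [pe pG]]]] : exists p e, I e /\ ev p e != 0 /\ poly_ev (ev p) (f p) G != 0.
    apply: contrapT => H; apply: JG; apply: JU => p e Ie pe.
    by apply/eqP; apply: contrapT => /negP pG; apply: H; exists p, e.
  exists e%:P; first by exists e.
  by move=> /(_ p)/eqP; rewrite rmorphM poly_evC mulf_eq0 (negPf pe) (negPf pG).
- by rewrite [LHS]poly_evC evC.
- exact: Jt0.
have [ps psE] := choice (fun s => @ev_point (qs s \o @polyC A) (qsC s)).
have pslim a : tends U (fun s => ev (ps s) a) (ev p0 a).
  rewrite -(poly_evC (ev p0) t0 a).
  by apply: tends_ext (qslim a%:P) => s; rewrite psE.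
apply: tends_unique (cont _ _ _ _ UU pslim).
rewrite -[X in tends _ _ X](poly_evX (ev p0) t0).
apply: tends_eq (qslim 'X); apply: filterS qse => s [_ [e [a ea] ->] qe].
have JG : graph_ideal f (e%:P * 'X - a%:P).
  by move=> p; rewrite rmorphB rmorphM !poly_evC poly_evX ea subrr.
have := qsJ s _ JG; rewrite rmorphB rmorphM -[qs s a%:P]psE -ea psE /= -mulrBr => /eqP.
by rewrite mulf_eq0 (negPf qe) /= subr_eq0 => /eqP.
Qed.

(** A relation of least degree has a single root [f p] at a general point [p] of
    a component, so its second coefficient is a multiple of [f p]. *)
Lemma closed_graph_fractional f : closed_graph f -> densely_fractional f.
Proof.
move=> clf c c0; pose J := graph_ideal f.
have [J0 JD JM] := graph_idealP f.
have id0 : is_ideal [set 0 : A].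
  by split=> //= [a b -> ->|a b ->]; rewrite ?addr0 ?mulr0.
pose M := [set a | exists m, a = c ^+ m].
have [||_ [m ->] /= /red/eqP|s [D [h [dom hS h0 sM]]]] :=
  @prime_quotient _ _ _ _ _ [set 0] M xC xS id0.
- by exists 0%N.
- by move=> _ _ [k ->] [l ->]; exists (k + l)%N; rewrite exprD.
- exact/negP.
have s0 : s != 0 by apply/eqP => s0; apply: (sM 1); [exists 0%N|rewrite /= s0 mulr0].
have domM a b : h a != 0 -> h b != 0 -> h (a * b) != 0.
  by move=> /eqP ha /eqP hb; rewrite rmorphM; apply/eqP => /dom[].
have hs : h s != 0.
  apply/eqP => /h0 /= ss; move/eqP: s0; apply; apply: (red (m := 2)).
  by rewrite expr2.
have hc : h c != 0 by apply/eqP => /h0 /=; apply: (sM c); exists 1%N.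
have nz a : h a != 0 -> a != 0 by apply: contraNneq => ->; rewrite rmorph0.
have ptn a : h a != 0 -> exists p, ev p s != 0 /\ ev p a != 0.
  move=> ha; have [p] := point_nonzero (nz _ (domM _ _ hs ha)).
  by rewrite rmorphM mulf_eq0 negb_or => /andP[]; exists p.
have hker p a : ev p s != 0 -> h a = 0 -> ev p a = 0.
  move=> ps /h0 /= /(congr1 (ev p)) /eqP; rewrite rmorphM rmorph0 mulf_eq0 (negPf ps) orbF.
  by move/eqP.
(* Multiplication by s kills the coefficients of G lying in the prime, so the top
   remaining one becomes the leading coefficient. *)
have strip G : J G -> map_poly h G != 0 ->
    exists G', [/\ J G', h (lead_coef G') != 0 & (size G' <= size G)%N].
  move=> JG hG; set k := (size (map_poly h G)).-1.
  have hk : h (s * G`_k) != 0.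
    by apply: domM => //; rewrite -coef_map -lead_coefE lead_coef_eq0.
  have sG : size (s *: G) = k.+1.
    apply/eqP; rewrite eqn_leq; apply/andP; split.
      apply/leq_sizeP => j kj; rewrite coefZ.
      have /h0 /= : h G`_j = 0.
        by rewrite -coef_map nth_default // (leq_trans _ kj) // leqSpred.
      by rewrite mulrC.
    rewrite ltnNge; apply/negP => /leq_sizeP/(_ k (leqnn _))/eqP.
    by rewrite coefZ; apply/negP/nz.
  exists (s *: G); split; first by rewrite -mul_polyC; apply: JM.
    by rewrite lead_coefE sG coefZ.
  exact: size_scale_leq.
pose Q k := `[< exists G, [/\ J G, h (lead_coef G) != 0 & size G = k] >].
have exQ : exists k, Q k.
  have [[G [JG hG]]|nG] := pselect (exists G, J G /\ map_poly h G != 0).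
    have [G' [JG' hG' _]] := strip _ JG hG.
    by exists (size G'); apply/asboolP; exists G'.
  have [|p [ps _]] := ptn 1; first by rewrite rmorph1 oner_neq0.
  have all t : t = f p.
    apply: clf => G JG; rewrite poly_evE -[RHS](horner0 t); congr (_.[t]).
    apply/polyP => i; rewrite coef_map coef0 /=; apply: hker ps _.
    rewrite -coef_map; apply/eqP; apply: contrapT => /negP Gi; apply: nG; exists G; split=> //.
    by apply: contraNneq Gi => ->; rewrite coef0.
  have := oner_neq0 K; rewrite {1}(all 1) -(all 0) eqxx //.
case: (ex_minnP exQ) => k /asboolP[F [JF ha sF]] kmin.
set a := lead_coef F in ha.
have small R i : J R -> (size R < size F)%N -> h R`_i = 0.
  move=> JR sR; apply/eqP; apply: contrapT => /negP Ri.
  have [|G [JG hG sG]] := strip R JR.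
    by apply: contraNneq Ri; rewrite -coef_map => ->; rewrite coef0.
  have : Q (size G) by apply/asboolP; exists G.
  by move/kmin; rewrite -sF leqNgt (leq_ltn_trans sG sR).
have F0 : F != 0 by rewrite -lead_coef_eq0 nz.
have roots p t : ev p s != 0 -> ev p a != 0 -> root (map_poly (ev p) F) t -> t = f p.
  move=> ps pa /rootP Ft; apply: clf => G JG.
  have := Pdiv.ComRing.rdivp_eq F G.
  set l := _ ^+ _; set H := Pdiv.CommonRing.rdivp _ _; set R := Pdiv.CommonRing.rmodp _ _ => E.
  have JR : J R.
    rewrite -(addKr (H * F) R) -E addrC; apply: JD; first by rewrite -mul_polyC; apply: JM.
    by rewrite -mulNr; apply: JM.
  have Rt : poly_ev (ev p) t R = 0.
    rewrite poly_evE (_ : map_poly (ev p) R = 0) ?horner0 //.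
    apply/polyP => i; rewrite coef_map coef0 /=; apply: hker ps _.
    by apply: small => //; apply: Pdiv.CommonRing.ltn_rmodpN0.
  have := congr1 (poly_ev (ev p) t) E.
  rewrite -mul_polyC rmorphD !rmorphM Rt [poly_ev _ _ F]Ft mulr0 addr0 poly_evC => /eqP.
  by rewrite rmorphXn mulf_eq0 expf_eq0 (negPf pa) andbF /= => /eqP.
have sF1 : (1 < size F)%N.
  rewrite ltnNge; apply/negP => /size1_polyC FE.
  have aE : F`_0 = a by rewrite /a FE lead_coefC coefC.
  have [p [ps pa]] := ptn a ha.
  by have /eqP := JF p; rewrite FE poly_evC aE (negPf pa).
pose m := (size F).-1.
have m0 : (0 < m)%N by rewrite /m -subn1 subn_gt0.
have key p : ev p s != 0 -> ev p a != 0 -> ev p F`_m.-1 = - (ev p a * m%:R * f p).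
  move=> ps pa; have [r rE] := closed_field_poly_normal (map_poly (ev p) F).
  have lE : lead_coef (map_poly (ev p) F) = ev p a by rewrite lead_coef_map_eq.
  have sr : size r = m.
    have := congr1 (fun p : {poly K} => (size p).-1) rE.
    by rewrite size_scale ?lE // size_prod_XsubC size_map_poly_id0 //= => <-.
  have rf z : z \in r -> z = f p.
    move=> zr; apply: roots => //; rewrite rE /root hornerZ mulf_eq0; apply/orP; right.
    by rewrite -/(root _ _) root_prod_XsubC.
  rewrite -coef_map rE lE coefZ -sr coefPn_prod_XsubC ?sr -?lt0n //.
  rewrite mulrN -mulrA; congr (- (_ * _)).
  rewrite (eq_big_seq (fun=> f p)) // big_const_seq count_predT sr.
  by rewrite iter_addr_0 mulr_natl.
have hm : h (sA m%:R) != 0.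
  by rewrite -[h _]/((h \o sA) m%:R) fmorph_eq0 pnatr_eq0 -lt0n.
(* The factor s confines the identity to the component, and the extra a makes
   both sides vanish where key does not apply. *)
exists (sA m%:R * s * a * a); first by apply: nz; rewrite !domM.
exists (- (c * s * a * F`_m.-1)) => p; rewrite rmorphN !rmorphM evC.
have [ps|ps] := eqVneq (ev p s) 0; first by rewrite ps !(mulr0, mul0r) oppr0.
have [pa|pa] := eqVneq (ev p a) 0; first by rewrite pa !(mulr0, mul0r) oppr0.
by rewrite key //; ring.
Qed.

End Graphs.

(** * Finite morphisms of affine varieties *)

Section Finite.
Local Open Scope ring_scope.

(** Multiplication by [b] on the generators is given by a matrix; its
    characteristic polynomial annihilates [b]. *)
Lemma finite_integral (A B : comNzRingType) (h : {rmorphism A -> B}) m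
    (e : 'I_m -> B) :
  (forall b, exists c : 'I_m -> A, b = \sum_(j < m) h (c j) * e j) ->
  forall b, integralOver h b.
Proof.
move=> egen b; have /choice[c cE] i := egen (b * e i).
pose M := \matrix_(i, j) c i j; pose N := b%:M - map_mx h M.
pose ecol := \col_j e j.
have N0 : N *m ecol = 0.
  apply/eqP; rewrite mulmxBl mul_scalar_mx subr_eq0; apply/eqP/colP => i.
  by rewrite !mxE cE; apply: eq_bigr => j _; rewrite !mxE.
have detN i : \det N * e i = 0.
  have : \det N *: ecol = 0 by rewrite -mul_scalar_mx -mul_adj_mx -mulmxA N0 mulmx0.
  by move/colP/(_ i); rewrite !mxE.
have det0 : \det N = 0.
  have [d dE] := egen 1; rewrite -[LHS]mulr1 dE mulr_sumr big1 // => i _.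
  by rewrite mulrCA detN mulr0.
exists (char_poly M); first exact: char_poly_monic.
rewrite rootE -horner_evalE -2!det_map_mx -det0.
suff -> : map_mx (horner_eval b) (map_mx (map_poly h) (char_poly_mx M)) = N by rewrite eqxx.
apply/matrixP => i j; rewrite !mxE raddfB raddfMn /= map_polyX map_polyC.
by rewrite /horner_eval hornerD hornerN hornerMn hornerX hornerC.
Qed.

Lemma finite_poly_integral (A B : comNzRingType) (h : {rmorphism A -> B}) m
    (e : 'I_m -> B) :
  (forall b, exists c : 'I_m -> A, b = \sum_(j < m) h (c j) * e j) ->
  forall G, integralOver (map_poly h) G.
Proof.
move=> egen; apply: (@finite_integral _ _ _ m (fun j => (e j)%:P)) => G.
have /choice[c cE] i := egen G`_i.
exists (fun j => \poly_(i < size G) c i j); apply/polyP => i.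
rewrite coef_sum; have [si|si] := ltnP i (size G); last first.
  rewrite nth_default // big1 // => j _.
  by rewrite coefMC coef_map coef_poly ltnNge si /= rmorph0 mul0r.
by rewrite cE; apply: eq_bigr => j _; rewrite coefMC coef_map coef_poly si.
Qed.

Lemma mv_generators (K : numClosedFieldType) (A : comNzRingType)
    (sA : {rmorphism K -> A}) n (g : 'I_n -> A) :
  exists x : {rmorphism mvpoly K n -> A},
    (forall c, x (mvpolyC K n c) = sA c) /\ (forall i, exists p, x p = g i).
Proof.
elim: n g => [|n IHn] g; first by exists sA; split=> // -[].
have [x [xC xg]] := IHn (fun i => g (lift ord_max i)).
exists (poly_ev x (g ord_max)); split=> [c|i]; first by rewrite poly_evC.
have [j ->|->] := unliftP ord_max i; last by exists 'X; rewrite poly_evX.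
by have [p pE] := xg j; exists p%:P; rewrite poly_evC.
Qed.

End Finite.

Section Variety.
Local Open Scope classical_set_scope.
Local Open Scope ring_scope.
Variables (R : realType).
Local Notation K := (R[i] : numClosedFieldType).

Lemma points_eq (X : affine_variety R) (p q : points X) : p =1 q -> p = q.
Proof.
case: p q => [[f [[f1] [f2]]] fC] [[g [[g1] [g2]]] gC] /= /funext fg.
move: f1 f2 fC g1 g2 gC; rewrite fg => f1 f2 fC g1 g2 gC.
by rewrite (Prop_irrelevance f1 g1) (Prop_irrelevance f2 g2) (Prop_irrelevance fC gC).
Qed.

Section NonTrivial.
Variables (X : affine_variety R) (nz : (1 : regular X) != 0).

(** C[X] as a nontrivial ring, which polynomials over it require; the zero ring
    is the case where X has no point. *)
Definition coord_ring : comNzRingType :=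
  HB.pack (GRing.ComPzRing.sort (regular X))
    (GRing.PzSemiRing_isNonZero.Build _ nz).

Definition ev (p : points X) : {rmorphism coord_ring -> K} := Defs.eval p.

Definition scal : {rmorphism K -> coord_ring} := Defs.scalar X.

Lemma coord_ring_generated : exists n (x : {rmorphism mvpoly K n -> coord_ring}),
  (forall c, x (mvpolyC K n c) = scal c) /\ (forall a, exists p, x p = a).
Proof.
have [x [xC xg]] := @mv_generators K coord_ring scal _ (@coordinate R X).
exists (embdim X), x; split=> // a.
suff : range x a by case=> p _ <-; exists p.
rewrite (@coordinate_generate R X (range x)) //.
- by move=> _ [c _ <-]; exists (mvpolyC K _ c) => //; exact: xC.
- by move=> _ [i _ <-]; have [p pE] := xg i; exists p.
- by move=> _ _ [p _ <-] [q _ <-]; exists (p + q) => //; exact: rmorphD.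
- by move=> _ _ [p _ <-] [q _ <-]; exists (p * q) => //; exact: rmorphM.
Qed.

Lemma ev_point (q : {rmorphism coord_ring -> K}) : (forall c, q (scal c) = c) ->
  exists p, forall a, ev p a = q a.
Proof. by move=> qC; exists (@Point R X q qC). Qed.

Lemma ev_nonzero (c : coord_ring) : c != 0 -> exists p, ev p c != 0.
Proof.
have [n [x [xC xS]]] := coord_ring_generated.
exact: (point_nonzero xC xS (@regular_reduced R X) ev_point).
Qed.

Lemma rational_densely_fractional f : rational_fun f -> densely_fractional ev f.
Proof.
move=> [U [Uop Udense Ureg]] c c0.
have [||p [Up [c' -> pc]]] := Udense [set p | exists2 a, [set c] a & p a != 0].
- by exists [set c].
- by have [p pc] := ev_nonzero c0; exists p; exists c.
have [V [a [b [[S ->] [e Se pe] _ Vab]]]] := Ureg p Up.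
have [pb _] : p b != 0 /\ f p = p a / p b by apply: Vab; exists e.
exists (e * b).
  apply/eqP => ceb; have : ev p (c * (e * b)) = 0 by rewrite ceb rmorph0.
  by rewrite !rmorphM => /eqP; rewrite !mulf_eq0 (negPf pc) (negPf pe) (negPf pb).
exists (c * e * a) => q; rewrite !rmorphM.
have [qe|qe] := eqVneq (ev q e) 0; first by rewrite qe !(mul0r, mulr0).
have [qb ->] : q b != 0 /\ f q = q a / q b by apply: Vab; exists e.
by rewrite -!mulrA [ev q b * _]mulrC divfK.
Qed.

Lemma densely_fractional_rational f : densely_fractional ev f -> rational_fun f.
Proof.
move=> frac; exists [set p | exists2 e, denominators ev f e & p e != 0]; split.
- by exists (denominators ev f).
- move=> _ [S ->] [p [c Sc pc]].
  have c0 : (c : coord_ring) != 0 by apply: contraNneq pc => ->; rewrite rmorph0.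
  have [d cd Dcd] := frac c c0; have [q qcd] := ev_nonzero cd.
  exists q; split; first by exists (c * d).
  by exists c => //; move: qcd; rewrite rmorphM mulf_eq0 negb_or => /andP[].
- move=> p [e De pe]; have [a ea] := De.
  exists [set q : points X | exists2 e', [set e] e' & q e' != 0], a, e; split.
  + by exists [set e].
  + by exists e.
  + by move=> q [_ -> qe]; exists e.
  + move=> q [_ -> qe]; split=> //.
    by apply: (mulfI qe); rewrite [LHS]ea mulrCA mulfV ?mulr1.
Qed.

Lemma euclidean_ultra_continuous f : euclidean_continuous f -> ultra_continuous ev f.
Proof.
move=> cont p T U qs UU qlim e e0.
have : nbhs (f p : R[i]^o) [set z : R[i]^o | `|z - f p| < e].
  by apply/nbhs_ballP; exists e => //= z; rewrite /ball /= distrC.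
move=> /(cont p)[_ [[B Bop <-] Bp BW]].
have [C CB sCB] : nbhs (embedding p) B by apply: open_nbhs_nbhs.
have : U [set t | forall i, C 0 i (embedding (qs t) 0 i)].
  apply: filter_forall => i; have /nbhs_ballP[d d0 dC] := CB 0 i.
  apply: filterS (qlim (coordinate i) d d0) => t td; apply: dC.
  by rewrite !mxE /ball /= distrC.
apply: filterS => t tC; apply: BW; apply: sCB => i j.
by rewrite (ord1 i); exact: tC.
Qed.

(** If some neighbourhood of [f p] had a preimage that is not a neighbourhood of
    [p], an ultrafilter converging to [p] would avoid this preimage. *)
Lemma ultra_euclidean_continuous f : ultra_continuous ev f -> euclidean_continuous f.
Proof.
move=> cont p W fpW; apply: contrapT => nW.
pose pE : initial_topology (@embedding R X) := p.
pose F : set_system (points X) := within (~` (f @^-1` W)) (nbhs pE).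
have FF : ProperFilter F.
  apply: Build_ProperFilter_ex => S FS.
  apply: contrapT => S0; apply: nW; apply: (@filterS _ (nbhs pE) (nbhs_filter pE) _ _ _ FS) => q /= qS.
  by apply: contrapT => qW; apply: S0; exists q; apply: qS.
have [U [UU FU]] := ultraFilterLemma FF.
have pU S : nbhs pE S -> U S.
  by move=> pS; apply: FU; apply: (@filterS _ (nbhs pE) (nbhs_filter pE) _ _ _ pS) => q Sq _.
have lim a : tends U (fun q => ev q a) (ev p a).
  pose S : set (regular X) := [set a | tends U (fun q => Defs.eval q a) (p a)].
  suff ST : S = setT by have : S a by rewrite ST.
  apply: coordinate_generate.
  - move=> _ [c _ <-]; rewrite /S /= eval_scalar.
    by apply: tends_ext (tends_cst c) => q; rewrite eval_scalar.
  - move=> _ [i _ <-] e e0; apply: pU.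
    have pV : nbhs (embedding p)
        [set v : 'rV[R[i]^o]_(embdim X) | `|v 0 i - p (coordinate i)| < e].
      exists (fun _ j => [set z : R[i]^o | j = i -> `|z - p (coordinate i)| < e]).
        move=> k j; apply/nbhs_ballP; exists e => //= z zp ji.
        by move: zp; rewrite ji !mxE /ball /= distrC.
      by move=> v /= vP; apply: vP.
    have := @initial_continuous _ _ (@embedding R X) pE _ pV.
    by apply: (@filterS _ (nbhs pE) (nbhs_filter pE)) => q /=; rewrite mxE.
  - by move=> b c ba ca; rewrite /S /= rmorphD; apply: tends_ext (tends_add ba ca) => q; rewrite rmorphD.
  - by move=> b c ba ca; rewrite /S /= rmorphM; apply: tends_ext (tends_mul ba ca) => q; rewrite rmorphM.
have /nbhs_ballP[e /= e0 eW] := fpW.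
have UW : U (~` (f @^-1` W)).
  by apply: FU; apply: (@filterE _ (nbhs pE) (nbhs_filter pE)).
have [q [qW /= qe]] := filter_ex (filterI UW (cont p _ U id UU lim e e0)).
by apply: qW; apply: eW; rewrite /ball /= distrC.
Qed.

Lemma K0_closed_graph f : K0 X f <-> closed_graph ev f /\ ultra_continuous ev f.
Proof.
have [n [x [xC xS]]] := coord_ring_generated.
have red : forall (a : coord_ring) m, a ^+ m = 0 -> a = 0 := @regular_reduced R X.
have evC p c : ev p (scal c) = c := @eval_scalar R X p c.
split=> [[/rational_densely_fractional frac /euclidean_ultra_continuous cont]|[clf cont]].
  by split=> //; exact: (fractional_closed_graph xC xS red evC ev_point frac cont).
split; last exact: ultra_euclidean_continuous.
apply: densely_fractional_rational.
exact: (closed_graph_fractional xC xS red evC ev_point clf).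
Qed.

End NonTrivial.

Lemma poly_ev_map (A B : comNzRingType) (h : {rmorphism A -> B})
    (r : {rmorphism B -> K}) (r' : {rmorphism A -> K}) t G :
  (forall a, r (h a) = r' a) -> poly_ev r t (map_poly h G) = poly_ev r' t G.
Proof.
by move=> rh; rewrite !poly_evE -map_poly_comp; congr horner; apply: eq_map_poly.
Qed.

Section Morphism.
Variables (X Y : affine_variety R) (pi : morphism Y X).
Hypothesis fin : finite_morphism pi.
Hypothesis domi : dominant pi.
Variables (nzX : (1 : regular X) != 0) (nzY : (1 : regular Y) != 0).
Let h : {rmorphism coord_ring nzX -> coord_ring nzY} := comorphism pi.

Lemma comorphism_integral b : integralOver h b.
Proof. by have [m [e egen]] := fin; exact: (@finite_integral (coord_ring nzX) (coord_ring nzY) h m e egen b). Qed.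

(** Lying over, with dominance providing the condition on the kernel. *)
Lemma on_points_surjective p : exists q, on_points pi q = p.
Proof.
have id0 : is_ideal [set 0 : coord_ring nzY].
  by split=> //= [a b -> ->|a b ->]; rewrite ?addr0 ?mulr0.
have [|q [qh _]] := lying_over comorphism_integral id0 (@eval_scalar R X p : forall c, ev nzX p (scal nzX c) = c).
  move=> a /= ha; suff -> : a = 0 by rewrite rmorph0.
  by apply: domi; rewrite [LHS]ha [RHS]rmorph0.
have qC c : q (scal nzY c) = c.
  by rewrite -[RHS](@eval_scalar R X p) -[scal nzY c](comorphism_scalar pi) [LHS]qh.
by exists (@Point R Y q qC); apply: points_eq => a; exact: qh.
Qed.

Lemma closed_graph_pullback f :
  closed_graph (ev nzX) f -> closed_graph (ev nzY) (f \o on_points pi).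
Proof.
move=> clf q t Jt; apply: clf => G JG.
rewrite -(@poly_ev_map _ _ h (ev nzY q)) //; apply: Jt => q'.
by rewrite (@poly_ev_map _ _ h _ (ev nzX (on_points pi q'))) //; apply: JG.
Qed.

(** A point (p, t) of the zero set of the relations of the graph of [f] lifts to
    a point (q, t) satisfying the relations of the graph of the composite. *)
Lemma closed_graph_pushforward f :
  closed_graph (ev nzY) (f \o on_points pi) -> closed_graph (ev nzX) f.
Proof.
move=> clg p t Jt; have [m [e egen]] := fin.
have pint := @finite_poly_integral (coord_ring nzX) (coord_ring nzY) h m e egen.
have Jid := graph_idealP (ev nzY) (f \o on_points pi).
have [||q [qh qJ]] := @lying_over K _ _ (@polyC (coord_ring nzX) \o scal nzX) _ _
  (poly_ev (ev nzX p) t) pint Jid.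
- by move=> c; rewrite [LHS]poly_evC; exact: eval_scalar.
- move=> G JG; apply: Jt => p'; have [q' <-] := on_points_surjective p'.
  by rewrite -(JG q') (@poly_ev_map _ _ h _ (ev nzX (on_points pi q'))).
pose q0 : {rmorphism coord_ring nzY -> K} := q \o @polyC (coord_ring nzY).
have q0h a : q0 (h a) = p a.
  by rewrite /q0 /= -[(h a)%:P](map_polyC h) qh poly_evC.
have q0C c : q0 (scal nzY c) = c.
  by rewrite -[RHS](@eval_scalar R X p) -[scal nzY c](comorphism_scalar pi) [LHS]q0h.
pose Q : points Y := @Point R Y q0 q0C.
have Qp : on_points pi Q = p by apply: points_eq => a; exact: q0h.
have qX : q 'X = t by rewrite -(map_polyX h) qh poly_evX.
rewrite -Qp; apply: clg => G JG; rewrite -(qJ G JG) -qX.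
rewrite [RHS]rmorph_poly_sum rmorph_poly_sum; apply: eq_bigr => i _.
by rewrite poly_evC poly_evX.
Qed.

Lemma ultra_continuous_pullback f :
  ultra_continuous (ev nzX) f -> ultra_continuous (ev nzY) (f \o on_points pi).
Proof.
move=> cont q T U qs UU qlim; apply: (cont _ _ _ _ UU) => a.
exact: (qlim (h a)).
Qed.

Lemma ultra_continuous_pushforward f :
  ultra_continuous (ev nzY) (f \o on_points pi) -> ultra_continuous (ev nzX) f.
Proof.
move=> cont p T U ps UU plim.
have [qs qsE] := choice (fun t => on_points_surjective (ps t)).
have qsh t a : ev nzY (qs t) (h a) = ev nzX (ps t) a by rewrite -(qsE t).
have [|q0 [q0h qlim]] := @point_limit K _ _ h T U (ev nzX p) (fun t => ev nzY (qs t)) UU comorphism_integral.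
  by move=> a; apply: tends_ext (plim a) => t; rewrite qsh.
have q0C c : q0 (scal nzY c) = c.
  by rewrite -[RHS](@eval_scalar R X p) -[scal nzY c](comorphism_scalar pi) [LHS]q0h.
pose Q : points Y := @Point R Y q0 q0C.
have Qp : on_points pi Q = p by apply: points_eq => a; exact: q0h.
rewrite -Qp; apply: tends_ext (cont Q T U qs UU qlim) => t.
by rewrite /= qsE.
Qed.

End Morphism.

Lemma trivial_points (X : affine_variety R) (p : points X) : (1 : regular X) != 0.
Proof.
apply/eqP => e; have : p 1 = p 0 by rewrite e.
by rewrite rmorph1 rmorph0 => /eqP; rewrite oner_eq0.
Qed.

Lemma K0_empty (X : affine_variety R) (f : points X -> R[i]) :
  (1 : regular X) = 0 -> K0 X f.
Proof.
move=> e; have noP (p : points X) : False.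
  by have := trivial_points p; rewrite e eqxx.
split; last by move=> p; case: (noP p).
exists setT; split=> [|V _ [p]|p]; try by case: (noP p).
by exists setT; apply/seteqP; split=> p; case: (noP p).
Qed.

End Variety.

Local Open Scope classical_set_scope.
Theorem proposition4p11 (R : realType) (X Y : affine_variety R)
    (pi : morphism Y X) :
  finite_morphism pi -> dominant pi ->
  [set f \o on_points pi | f in K0 X] =
  [set g | K0 Y g /\ constant_on_fibers pi g].
Proof.
move=> fin domi; have [e|/eqP nzX] := pselect (1 = 0 :> regular X)%R.
  have eY : (1 = 0 :> regular Y)%R by rewrite -(rmorph1 (comorphism pi)) e rmorph0.
  apply/seteqP; split=> g.
    move=> [f _ <-]; split; first exact: K0_empty.
    by move=> q1 q2 /= ->.
  move=> _; exists (fun=> 0%R); first exact: K0_empty.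
  by apply/funext => q; have := trivial_points q; rewrite eY eqxx.
have nzY : (1 != 0 :> regular Y)%R.
  by apply: contraNneq nzX => e; apply/eqP/domi; rewrite rmorph1 rmorph0.
apply/seteqP; split=> g.
  move=> [f /(K0_closed_graph nzX)[clf cont] <-]; split; last by move=> q1 q2 /= ->.
  apply/(K0_closed_graph nzY); split; first exact: closed_graph_pullback.
  exact: ultra_continuous_pullback cont.
move=> [/(K0_closed_graph nzY)[clg cont] cfib].
have [s sE] := choice (on_points_surjective fin domi nzX nzY).
have gE : (g \o s) \o on_points pi = g.
  by apply/funext => q; apply: cfib; rewrite sE.
exists (g \o s) => //; rewrite -gE in clg cont.
apply/(K0_closed_graph nzX); split.
  exact: closed_graph_pushforward clg.
exact: ultra_continuous_pushforward cont.
Qed.
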